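(* For each $g>1$, there exist infinitely many linearly independent quasi-invariants on the set of genus $g$ Heegaard splittings of closed orientable 3-manifolds. That is, let $S$ be the boundary of the genus $g$ handlebody $H$, let $\mathcal{H}<\mathrm{Mod}(S)$ be the handlebody group of $H$, and let $\sim$ be the equivalence relation on $\mathrm{Mod}(S)$ given by $\phi\sim\phi'$ if and only if $\mathcal{H}\phi\mathcal{H}=\mathcal{H}\phi'\mathcal{H}$; then there exists an infinite family of quasi-invariants on $\mathrm{Mod}(S)/\!\sim$ such that every finite subfamily of distinct members is linearly independent (i.e. not linearly dependent in the sense defined in the context).
   Context: For a set $X$ with an equivalence relation $\sim$, a function $f:X\to\mathbb{R}$ is called a quasi-invariant on $X/\!\sim$ if there exists $K\ge 0$ such that $|f(x)-f(y)|\le K$ whenever $x\sim y$. Quasi-invariants $f_1,\ldots,f_n$ on a set $X$ with an equivalence relation $\sim$ are linearly dependent if there exist $(a_1,\ldots,a_n)\in\mathbb{R}^n\setminus\{0\}$ and $M>0$ such that $|a_1f_1(x)+\cdots+a_nf_n(x)|<M$ for all $x\in X$. $\mathrm{Mod}(S)=\pi_0(\mathrm{Diff}^+(S))$ is the mapping class group of the closed oriented surface $S$, i.e. the group of isotopy classes of orientation-preserving homeomorphisms (equivalently diffeomorphisms) of $S$. The handlebody group $\mathcal{H}$ of $H$ is the subgroup of $\mathrm{Mod}(S)$ of mapping classes that extend over $H$, i.e. are represented by a homeomorphism of $S$ that extends to a homeomorphism of $H$. For $\phi\in\mathrm{Mod}(S)$, the double coset $\mathcal{H}\phi\mathcal{H}$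 gives a genus $g$ Heegaard splitting of a closed orientable 3-manifold (obtained by gluing two copies of $H$ along their boundaries by $\phi$), and the set of genus $g$ Heegaard splittings is understood as the set of these double cosets. *)

(* Defs.v *)
From HB Require Import structures.
From mathcomp Require Import all_boot all_order all_algebra.
From mathcomp Require Import generic_quotient.
From mathcomp Require Import all_classical all_reals all_analysis.

Set Implicit Arguments.
Unset Strict Implicit.
Unset Printing Implicit Defensive.

Import Order.TTheory GRing.Theory Num.Theory.
Import numFieldNormedType.Exports.

Local Open Scope classical_set_scope.
Local Open Scope ring_scope.
Local Open Scope quotient_scope.

Definition is_homeo (X Y : topologicalType) (f : X -> Y) : Prop :=
  exists g : Y -> X,
    [/\ cancel f g, cancel g f, continuous f & continuous g].

(* Orientations of surfaces. A chart of S is given by its inverse, an open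
   embedding of the plane into S. *)
Section Orientation.
Variables (R : realType) (S : topologicalType).

Definition plane : topologicalType := (R * R)%type.

Definition is_chart (phi : plane -> S) : Prop :=
  [/\ continuous phi, injective phi &
      forall U : set plane, open U -> open (phi @` U)].

(* The point at distance r from c in the direction of angle 2 pi t. *)
Definition polar (c : plane) (r t : R) : plane :=
  (c.1 + r * cos (2 * pi * t), c.2 + r * sin (2 * pi * t)).

(* The transition map tau = psi^-1 \o phi is orientation preserving: at every
   point p where it is defined, with q = tau p, its local degree is 1, i.e. tau
   sends every small enough circle centred at p to a loop of winding number 1
   around q. *)
Definition positive_transition (phi psi : plane -> S) : Prop :=
  forall p q : plane, phi p = psi q ->
    \forall r \near 0^'+, exists rho theta : R -> R,
      [/\ {within `[0, 1], continuous rho},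
          {within `[0, 1], continuous theta},
          theta 1 = theta 0 + 1 &
          forall t : R, t \in `[0, 1] ->
            0 < rho t /\ phi (polar p r t) = psi (polar q (rho t) (theta t))].

(* An orientation is a maximal atlas with orientation-preserving transitions. *)
Record orientation := Orientation {
  oriented_charts :> set (plane -> S);
  oriented_chartP : forall phi, oriented_charts phi -> is_chart phi;
  oriented_cover : forall x, exists phi p, oriented_charts phi /\ phi p = x;
  oriented_transition : forall phi psi,
    oriented_charts phi -> oriented_charts psi -> positive_transition phi psi;
  oriented_maximal : forall phi, is_chart phi ->
    (forall psi, oriented_charts psi -> positive_transition phi psi) ->
    oriented_charts phi
}.

End Orientation.

(* The group of orientation-preserving homeomorphisms of S: those which map the
   oriented atlas onto itself. *)
Section OrientedHomeo.
Variables (R : realType) (S : topologicalType) (o : orientation R S).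

Record ohomeo := OHomeo {
  ohomeo_fun :> S -> S;
  ohomeo_homeo : is_homeo ohomeo_fun;
  ohomeo_oriented : forall phi,
    oriented_charts o (ohomeo_fun \o phi) <-> oriented_charts o phi
}.

HB.instance Definition _ := gen_eqMixin ohomeo.
HB.instance Definition _ := gen_choiceMixin ohomeo.

Lemma ohomeo_eq (f g : ohomeo) : f =1 g -> f = g.
Proof.
case: f g => [f hf of_] [g hg og] /= /funext fg; subst g.
by congr OHomeo; exact: Prop_irrelevance.
Qed.

Lemma is_homeo_id : is_homeo (@id S).
Proof. by exists id; split => // x; exact: cvg_id. Qed.

Lemma is_homeo_comp (f g : S -> S) :
  is_homeo f -> is_homeo g -> is_homeo (f \o g).
Proof.
move=> [f' [fK f'K cf cf']] [g' [gK g'K cg cg']]; exists (g' \o f').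
split.
- exact: can_comp.
- exact: can_comp.
- by move=> x; apply: continuous_comp; [exact: cg|exact: cf].
- by move=> x; apply: continuous_comp; [exact: cf'|exact: cg'].
Qed.

Lemma ohomeo_mul_oriented (f g : ohomeo) phi :
  oriented_charts o ((f \o g) \o phi) <-> oriented_charts o phi.
Proof. by rewrite -compA (ohomeo_oriented f) (ohomeo_oriented g). Qed.

Definition ohomeo_one : ohomeo :=
  OHomeo is_homeo_id (fun phi => iff_refl (oriented_charts o phi)).

Definition ohomeo_mul (f g : ohomeo) : ohomeo :=
  OHomeo (is_homeo_comp (ohomeo_homeo f) (ohomeo_homeo g))
    (ohomeo_mul_oriented f g).

Definition ohomeo_inv_fun (f : ohomeo) : S -> S :=
  sval (cid (ohomeo_homeo f)).

Lemma ohomeo_inv_funP (f : ohomeo) :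
  [/\ cancel f (ohomeo_inv_fun f), cancel (ohomeo_inv_fun f) f,
      continuous f & continuous (ohomeo_inv_fun f)].
Proof. exact: (svalP (cid (ohomeo_homeo f))). Qed.

Lemma ohomeoK (f : ohomeo) : cancel f (ohomeo_inv_fun f).
Proof. by have [] := ohomeo_inv_funP f. Qed.

Lemma ohomeoVK (f : ohomeo) : cancel (ohomeo_inv_fun f) f.
Proof. by have [] := ohomeo_inv_funP f. Qed.

Lemma ohomeo_inv_homeo (f : ohomeo) : is_homeo (ohomeo_inv_fun f).
Proof. by have [fK f'K cf cf'] := ohomeo_inv_funP f; exists f. Qed.

Lemma ohomeo_inv_oriented (f : ohomeo) phi :
  oriented_charts o (ohomeo_inv_fun f \o phi) <-> oriented_charts o phi.
Proof.
rewrite -(ohomeo_oriented f) compA (_ : f \o _ = id)//.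
by apply/funext => x /=; rewrite ohomeoVK.
Qed.

Definition ohomeo_inv (f : ohomeo) : ohomeo :=
  OHomeo (ohomeo_inv_homeo f) (ohomeo_inv_oriented f).

Lemma ohomeo_mulA : associative ohomeo_mul.
Proof. by move=> f g h; exact: ohomeo_eq. Qed.

Lemma ohomeo_mul1g : left_id ohomeo_one ohomeo_mul.
Proof. by move=> f; exact: ohomeo_eq. Qed.

Lemma ohomeo_mulg1 : right_id ohomeo_one ohomeo_mul.
Proof. by move=> f; exact: ohomeo_eq. Qed.

Lemma ohomeo_mulVg : left_inverse ohomeo_one ohomeo_inv ohomeo_mul.
Proof. by move=> f; apply: ohomeo_eq => x /=; rewrite ohomeoK. Qed.

Lemma ohomeo_mulgV : right_inverse ohomeo_one ohomeo_inv ohomeo_mul.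
Proof. by move=> f; apply: ohomeo_eq => x /=; rewrite ohomeoVK. Qed.

HB.instance Definition _ := isGroup.Build ohomeo
  ohomeo_mulA ohomeo_mul1g ohomeo_mulg1 ohomeo_mulVg ohomeo_mulgV.

End OrientedHomeo.

Section Isotopy.
Variables (R : realType) (S : topologicalType).

Definition isotopic (f g : S -> S) : Prop :=
  exists F : R * S -> S,
    [/\ {within `[0, 1] `*` setT, continuous F},
        forall t : R, t \in `[0, 1] -> is_homeo (fun x => F (t, x)),
        forall x, F (0, x) = f x &
        forall x, F (1, x) = g x].

Lemma isotopic_refl (f : S -> S) : is_homeo f -> isotopic f f.
Proof.
move=> hf; exists (fun p => f p.2); split => //.
apply: continuous_subspaceT => p; apply: continuous_comp; first exact: cvg_snd.
by case: hf => g [_ _ cf _]; exact: cf.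
Qed.

Lemma isotopic_sym (f g : S -> S) : isotopic f g -> isotopic g f.
Proof.
move=> [F [cF hF F0 F1]].
have A1 t : t \in (`[0, 1] : interval R) -> 1 - t \in (`[0, 1] : interval R).
  by rewrite !in_itv /= subr_ge0 lerBlDr lerDl andbC.
exists (fun p => F (1 - p.1, p.2)); split.
- apply/subspace_continuousP => -[t x] /= [At _].
  pose rev (p : R * S) := (1 - p.1, p.2).
  have crev : continuous rev.
    move=> p; rewrite /rev /=.
    apply: (@cvg_pair _ _ _ _ (nbhs (1 - p.1)) (nbhs p.2)).
    - by apply: cvgB; [exact: cvg_cst | exact: cvg_fst].
    - exact: cvg_snd.
  move/subspace_continuousP : cF => /(_ (rev (t, x))) cF.
  have Arev : (`[0, 1] `*` setT) (rev (t, x)) by split => //; exact: A1.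
  apply: (@cvg_comp _ _ _ rev F _ _ _ _ (cF Arev)).
  move=> U /(crev (t, x)) crevU.
  apply: (@filterS _ (nbhs (t, x)) _ _ _ _ crevU) => p /= Up [Ap _].
  by apply: Up; split => //; exact: A1.
- by move=> t At; exact: hF (A1 _ At).
- by move=> x; rewrite subr0.
- by move=> x; rewrite subrr.
Qed.

Lemma isotopic_comp (f g f' g' : S -> S) :
  isotopic f g -> isotopic f' g' -> isotopic (f \o f') (g \o g').
Proof.
move=> [F [cF hF F0 F1]] [F' [cF' hF' F'0 F'1]].
exists (fun p => F (p.1, F' p)); split.
- apply/subspace_continuousP => p Ap.
  pose G (q : R * S) := (q.1, F' q).
  move/subspace_continuousP : cF => /(_ (G p)) cF.
  move/subspace_continuousP : cF' => /(_ p Ap) cF'.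
  have AG : (`[0, 1] `*` setT) (G p) by case: Ap.
  apply: (@cvg_comp _ _ _ G F _ _ _ _ (cF AG)).
  have cG : G q @[q --> within (`[0, 1] `*` setT) (nbhs p)] --> G p.
    apply: (@cvg_pair _ _ _ _ (nbhs p.1) (nbhs (F' p))) => //.
    by apply: cvg_trans (cvg_app _ (cvg_within _)) _; exact: cvg_fst.
  move=> U /cG cGU; apply: (@filterS _ (nbhs p) _ _ _ _ cGU) => q /= Uq Aq.
  by apply: (Uq Aq); case: Aq.
- by move=> t At; have := is_homeo_comp (hF _ At) (hF' _ At).
- by move=> x /=; rewrite F'0 F0.
- by move=> x /=; rewrite F'1 F1.
Qed.

End Isotopy.

(* Mod(S), the quotient of the group of orientation-preserving homeomorphisms
   by isotopy. *)
Section MappingClassGroup.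
Variables (R : realType) (S : topologicalType) (o : orientation R S).
Local Open Scope group_scope.

Definition isotopicb (f g : ohomeo o) : bool := `[< @isotopic R S f g >].

Lemma isotopicb_refl : reflexive isotopicb.
Proof. by move=> f; apply/asboolP/isotopic_refl/ohomeo_homeo. Qed.

Lemma isotopicb_sym : symmetric isotopicb.
Proof. by move=> f g; apply/asboolP/asboolP; exact: isotopic_sym. Qed.

Lemma isotopicb_mul (f g f' g' : ohomeo o) :
  isotopicb f g -> isotopicb f' g' -> isotopicb (f * f') (g * g').
Proof. by move=> /asboolP fg /asboolP fg'; apply/asboolP/isotopic_comp. Qed.

Lemma isotopicb_trans : transitive isotopicb.
Proof.
move=> g f h fg gh.
have := isotopicb_mul gh (isotopicb_mul (isotopicb_refl g^-1) fg).
by rewrite mulVKg mulVg mulg1.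
Qed.

Lemma isotopicb_inv (f g : ohomeo o) : isotopicb f g -> isotopicb f^-1 g^-1.
Proof.
rewrite isotopicb_sym => gf.
have := isotopicb_mul (isotopicb_refl f^-1)
  (isotopicb_mul gf (isotopicb_refl g^-1)).
by rewrite mulgV mulg1 mulKg.
Qed.

Canonical isotopicb_equiv : equiv_rel (ohomeo o) :=
  EquivRel isotopicb isotopicb_refl isotopicb_sym isotopicb_trans.

Definition mcg : Type := {eq_quot isotopicb_equiv}.
HB.instance Definition _ := Choice.on mcg.
HB.instance Definition _ := EqQuotient.on mcg.

Definition mcg_one : mcg := \pi_mcg 1.
Definition mcg_mul (x y : mcg) : mcg := \pi_mcg (repr x * repr y).
Definition mcg_inv (x : mcg) : mcg := \pi_mcg (repr x)^-1.

Lemma isotopicb_repr (f : ohomeo o) : isotopicb (repr (\pi_mcg f)) f.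
Proof. by apply/eqmodP; rewrite reprK. Qed.

Lemma mcg_mulE (f g : ohomeo o) :
  mcg_mul (\pi_mcg f) (\pi_mcg g) = \pi_mcg (f * g).
Proof.
by apply/eqmodP; apply: isotopicb_mul; exact: isotopicb_repr.
Qed.

Lemma mcg_invE (f : ohomeo o) : mcg_inv (\pi_mcg f) = \pi_mcg f^-1.
Proof.
by apply/eqmodP; apply: isotopicb_inv; exact: isotopicb_repr.
Qed.

Lemma mcg_mulA : associative mcg_mul.
Proof.
move=> x y z.
rewrite -[x]reprK -[y]reprK -[z]reprK.
rewrite (mcg_mulE (repr y) (repr z)) (mcg_mulE (repr x) (repr y)).
by rewrite (mcg_mulE (repr x)) (mcg_mulE _ (repr z)) mulgA.
Qed.

Lemma mcg_mul1g : left_id mcg_one mcg_mul.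
Proof. by move=> x; rewrite -[x]reprK mcg_mulE mul1g. Qed.

Lemma mcg_mulg1 : right_id mcg_one mcg_mul.
Proof. by move=> x; rewrite -[x]reprK mcg_mulE mulg1. Qed.

Lemma mcg_mulVg : left_inverse mcg_one mcg_inv mcg_mul.
Proof. by move=> x; rewrite -[x]reprK mcg_invE mcg_mulE mulVg. Qed.

Lemma mcg_mulgV : right_inverse mcg_one mcg_inv mcg_mul.
Proof. by move=> x; rewrite -[x]reprK mcg_invE mcg_mulE mulgV. Qed.

HB.instance Definition _ := isGroup.Build mcg
  mcg_mulA mcg_mul1g mcg_mulg1 mcg_mulVg mcg_mulgV.

End MappingClassGroup.

Section Heegaard.
Variables (R : realType) (g : nat).

Definition space : topologicalType := (R * R * R)%type.

(* The genus g handlebody, as the product with [0, 1] of the disc of radius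
   3g + 1 around the origin with g open unit discs removed, centred at (3i, 0)
   for i < g. *)
Definition handlebody : set space :=
  [set p | [/\ p.1.1 ^+ 2 + p.1.2 ^+ 2 <= (3 * g + 1)%N%:R ^+ 2,
               forall i : 'I_g, 1 <= (p.1.1 - (3 * i)%N%:R) ^+ 2 + p.1.2 ^+ 2 &
               0 <= p.2 <= 1]].

(* The manifold boundary of the handlebody is its frontier in space; it is
   contained in the handlebody, which is closed. *)
Definition handlebody_boundary : set space :=
  closure handlebody `\` interior handlebody.

Definition handlebody_space : topologicalType := set_type handlebody.
Definition boundary_surface : topologicalType := set_type handlebody_boundary.

Definition extends_over_handlebody
    (f : boundary_surface -> boundary_surface) : Prop :=
  exists F : handlebody_space -> handlebody_space, is_homeo F /\
    forall (x : boundary_surface) (y : handlebody_space),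
      set_val y = set_val x -> set_val (F y) = set_val (f x).

Variable o : orientation R boundary_surface.

Definition handlebody_group : set (mcg o) :=
  [set \pi_(mcg o) f | f in [set f : ohomeo o | extends_over_handlebody f]].

Definition double_coset (G : groupType) (K : set G) (x : G) : set G :=
  [set (a * x * b)%g | a in K & b in K].

(* Two mapping classes are equivalent when they define the same genus g
   Heegaard splitting. *)
Definition heegaard_equiv (phi phi' : mcg o) : Prop :=
  double_coset handlebody_group phi = double_coset handlebody_group phi'.

End Heegaard.

Section QuasiInvariants.
Variables (R : realType) (X : Type).

Definition quasi_invariant (sim : X -> X -> Prop) (f : X -> R) : Prop :=
  exists2 K : R, 0 <= K & forall x y, sim x y -> `|f x - f y| <= K.

Definition linearly_dependent (n : nat) (f : 'I_n -> X -> R) : Prop :=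
  exists (a : 'rV[R]_n) (M : R),
    [/\ a != 0, 0 < M & forall x, `|\sum_(i < n) a 0 i * f i x| < M].

End QuasiInvariants.

(* Main.v *)
Require Import Defs.
From mathcomp Require Import all_boot all_order all_algebra.
From mathcomp Require Import generic_quotient.
From mathcomp Require Import all_classical all_reals all_analysis.
From mathcomp Require Import ring lra zify.

(** A function on Mod(S) that is constant on the classes of the equivalence
relation is a quasi-invariant with constant 0.  It is therefore enough to find
infinitely many classes, indexed by a function [nu] with values in the natural
numbers that is constant on classes and takes every value: the functions equal
to [nu] on the points where the 2-adic valuation of [nu] is [j], and to 0
elsewhere, are unbounded with disjoint supports as [j] varies, so no
nontrivial linear combination of them is bounded.

The classes are those of the powers [T^k] of the Dehn twist [T] along a curve
around one handle.  They are told apart by a cohomological invariant.  Write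
H^1(S) for the group of homotopy classes of maps from S to the circle, and L
for the subgroup of the classes of maps that extend over the handlebody.  The
handlebody group preserves L, so the set of all [d] such that
<<phi^* L is contained in L + d H^1(S)>> depends only on the double coset of
[phi].  For [phi = T^k] this set contains [k], because [T^* - 1] has square
zero and hence [(T^k)^* = 1 + k (T^* - 1)].  Conversely every [d] in the set
divides [k]: the angle around the hole is in L, and its composite with [T^k]
has degree [k] on a meridian, whereas maps in L have degree 0 on the meridian,
which bounds a disc.  Hence [T^k] and [T^l] are equivalent only if [k] and [l]
divide each other ([twist_class_inj]).

Two things have to be built.  The first is degree theory for maps to the
circle R/Z.  Such a map is represented by a real function, in general
discontinuous, that is continuous modulo integers; the group law is then the
addition of functions.  Everything follows from the lifting of homotopies
([homotopy_lift]).  The second is that the twist preserves the given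
orientation, which is an arbitrary maximal atlas.  Being positive at a point
is unchanged along an isotopy of germs ([isotopy_positive]), and near any
given point of S the twist is isotopic to the identity, although it is not
isotopic to the identity on the whole of S ([twist_oriented_sub]). *)

Set Implicit Arguments.
Unset Strict Implicit.
Unset Printing Implicit Defensive.

Import Order.TTheory GRing.Theory Num.Theory.
Import numFieldNormedType.Exports.

Local Open Scope classical_set_scope.
Local Open Scope ring_scope.

(** * Circle-valued functions and the lifting of homotopies *)

Section CentredResidue.
Variable R : realType.
Implicit Types a b : R.

(** The representative of [a] modulo 1 in the interval from -1/2 to 1/2; its
absolute value is the distance from [a] to the integers, that is, the norm of
the class of [a] in R/Z. *)
Definition cres (a : R) : R := a - (Num.floor (a + 2^-1))%:~R.

Lemma cres_itv a : - 2^-1 <= cres a < 2^-1.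
Proof.
have := floor_itv (a + 2^-1); rewrite /cres intrD.
set n := intr _; lra.
Qed.

Lemma subr_cres_int a : a - cres a \is a Num.int.
Proof. by rewrite /cres opprB addrC subrK. Qed.

Lemma cres_eq a b : a - b \is a Num.int -> cres a = cres b.
Proof.
move=> ab; rewrite /cres (_ : a + 2^-1 = b + 2^-1 + (a - b)); last by ring.
by rewrite floorDrz// intrD (floorK ab); set n := intr _; ring.
Qed.

Lemma cres_id a : - 2^-1 <= a < 2^-1 -> cres a = a.
Proof.
move=> ha; rewrite /cres (_ : Num.floor _ = 0) ?subr0//.
by apply: floor_def; rewrite add0r mulr0z mulr1z; lra.
Qed.

Lemma cres_int a : a \is a Num.int -> cres a = 0.
Proof.
by move=> ha; rewrite (@cres_eq a 0) ?subr0// cres_id//; lra.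
Qed.

(** [cres a] is the smallest element in absolute value of its class modulo 1,
since any other element differs from it by at least 1. *)
Lemma norm_cres_le a : `|cres a| <= `|a|.
Proof.
have := cres_itv a; have [n na] := intrP (subr_cres_int a).
have -> : a = cres a + n%:~R by rewrite -na addrC subrK.
rewrite (@cres_eq (cres a + n%:~R) (cres a)); last first.
  by rewrite addrC addKr intr_int.
rewrite (cres_id (cres_itv a)).
have [n0|n0|->] := ltrgtP n 0; last by rewrite mulr0z addr0.
- have : n%:~R <= (-1)%:~R :> R by rewrite ler_int; lia.
  rewrite mulrN1z => ? ?; rewrite ler_norml.
  by have := ler_norm (- (cres a + n%:~R)); rewrite normrN; lra.
- have : 1%:~R <= n%:~R :> R by rewrite ler_int; lia.
  rewrite mulr1z => ? ?; rewrite ler_norml.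
  by have := ler_norm (cres a + n%:~R); lra.
Qed.

Lemma norm_cresD a b : `|cres (a + b)| <= `|cres a| + `|cres b|.
Proof.
rewrite (@cres_eq (a + b) (cres a + cres b)).
  exact: le_trans (norm_cres_le _) (ler_normD _ _).
by rewrite opprD addrACA rpredD// subr_cres_int.
Qed.

Lemma norm_cresN a : `|cres (- a)| = `|cres a|.
Proof.
have N b : `|cres (- b)| <= `|cres b|.
  rewrite (@cres_eq (- b) (- cres b)); last first.
    by rewrite -opprD rpredN subr_cres_int.
  by rewrite -(normrN (cres b)) norm_cres_le.
by apply/le_anti/andP; split; [exact: N|rewrite -{1}(opprK a); exact: N].
Qed.

End CentredResidue.

Lemma continuous_pair (X Y Z : topologicalType) (f : X -> Y) (g : X -> Z) x :
  {for x, continuous f} -> {for x, continuous g} ->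
  {for x, continuous (fun y => (f y, g y))}.
Proof.
by move=> cf cg; exact: (@cvg_pair _ _ _ _ (nbhs (f x)) (nbhs (g x))).
Qed.

Section CircleContinuous.
Variable R : realType.

(** Continuity at [x] of the map to R/Z represented by [u].  Representing a
circle-valued map by real values makes the product of maps an addition, and
leaves the choice of a branch free: [u] itself may jump by integers. *)
Definition circle_cvg (X : topologicalType) (u : X -> R) (x : X) : Prop :=
  forall e : R, 0 < e -> \forall y \near x, `|cres (u y - u x)| < e.

Definition circle_continuous (X : topologicalType) (u : X -> R) : Prop :=
  forall x, circle_cvg u x.

Variables X Y : topologicalType.
Implicit Types (u v : X -> R) (x : X).

Lemma cvg_circle u x : {for x, continuous u} -> circle_cvg u x.
Proof.
move=> cu e e0; move: cu => /cvgr_dist_lt/(_ e e0).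
apply: filterS => y; rewrite distrC; exact: le_lt_trans (norm_cres_le _).
Qed.

Lemma circle_cvg_comp (u : Y -> R) (f : X -> Y) x :
  {for x, continuous f} -> circle_cvg u (f x) -> circle_cvg (u \o f) x.
Proof. by move=> cf cu e e0; have := cf _ (cu e e0). Qed.

Lemma circle_cvgD u v x :
  circle_cvg u x -> circle_cvg v x -> circle_cvg (u \+ v) x.
Proof.
move=> cu cv e e0; have e2 : 0 < e / 2 by lra.
near=> y.
have hu : `|cres (u y - u x)| < e / 2 by near: y; exact: cu.
have hv : `|cres (v y - v x)| < e / 2 by near: y; exact: cv.
rewrite /= opprD addrACA.
apply: le_lt_trans (norm_cresD _ _) _; lra.
Unshelve. all: by end_near. Qed.

Lemma circle_cvgN u x : circle_cvg u x -> circle_cvg (\- u) x.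
Proof.
move=> cu e e0; apply: filterS (cu e e0) => y.
by rewrite /= -opprD norm_cresN.
Qed.

Lemma circle_cvg_int u v x :
  (forall y, u y - v y \is a Num.int) -> circle_cvg u x -> circle_cvg v x.
Proof.
move=> uv cu e e0; apply: filterS (cu e e0) => y.
rewrite (@cres_eq R (v y - v x) (u y - u x))//.
rewrite (_ : _ - _ = - (u y - v y) + (u x - v x)); last by ring.
by rewrite rpredD ?rpredN.
Qed.

(** Away from the cut locus 1/2, the circle has [cres] as a continuous section
of the projection from R; this is the only local lift that is needed. *)
Lemma continuous_cres u x : circle_cvg u x -> `|cres (u x)| < 2^-1 ->
  {for x, continuous (fun y => cres (u y))}.
Proof.
move=> cu ux; apply/cvgrPdist_lt => e e0.
pose d := 2^-1 - `|cres (u x)|.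
have d0 : 0 < d by rewrite /d; lra.
near=> y.
have h1 : `|cres (u y - u x)| < e by near: y; exact: cu.
have h2 : `|cres (u y - u x)| < d by near: y; exact: cu.
suff -> : cres (u y) = cres (u x) + cres (u y - u x).
  by rewrite opprD addrA subrr add0r normrN.
have : `|cres (u x) + cres (u y - u x)| < 2^-1.
  apply: le_lt_trans (ler_normD _ _) _; rewrite /d in h2; lra.
rewrite ltr_norml => ?; rewrite -[RHS]cres_id; last by lra.
apply: cres_eq; rewrite (_ : _ - _ = (u x - cres (u x)) +
  ((u y - u x) - cres (u y - u x))); last by ring.
by rewrite rpredD// subr_cres_int.
Unshelve. all: by end_near. Qed.

End CircleContinuous.

Section HomotopyLifting.
Variable R : realType.

(** The connectedness of the line, in the form of an induction principle: a
symmetric and transitive relation that relates each point to all nearby points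
relates any two points.  It serves for lifting, for the uniqueness of the
degree and for orientations. *)
Lemma locally_constant_rel (E : R -> R -> Prop) :
  (forall s t, E s t -> E t s) -> (forall s t r, E s t -> E t r -> E s r) ->
  (forall s, \forall t \near s, E s t) -> forall s t, E s t.
Proof.
move=> Esym Etrans Eloc s t.
have cR : connected [set: R] by apply/connected_intervalP => ? *.
have Ess : E s s by exact: nbhs_singleton (Eloc s).
have oE r : open (E r).
  rewrite openE => x rx; rewrite /interior; near=> y.
  by apply: Etrans rx _; near: y; exact: Eloc.
have : (E s : set R) = setT.
  apply: cR; first by exists s.
  - by exists (E s); rewrite ?setTI.
  - exists (E s); rewrite ?setTI// -[E s]setCK; apply: open_closedC.
    rewrite openE => x sx; rewrite /interior; near=> y => sy; apply: sx.
    apply: Etrans sy _; apply: Esym; near: y; exact: Eloc.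
by move=> /seteqP[_ /(_ t I)].
Unshelve. all: by end_near. Qed.

Variables (X : topologicalType) (C : set X) (K : R * X -> R).
Hypotheses (cC : compact C) (cK : circle_continuous K).

(** The variation of the homotopy [K] between the times [s] and [t] lifts to a
real function, continuous on [C].  The last clause makes the lift depend only
on the path traced by the point: it turns a homotopy of loops into a function
with equal values at the ends of the loop, and so makes the degree
invariant. *)
Definition lift_step (s t : R) : Prop := exists h : X -> R,
  [/\ forall x, C x -> {for x, continuous h},
      forall x, K (t, x) - K (s, x) - h x \is a Num.int &
      forall x y, (forall r, K (r, x) - K (r, y) \is a Num.int) -> h x = h y].

Lemma lift_step_sym s t : lift_step s t -> lift_step t s.
Proof.
move=> [h [ch hh eh]]; exists (\- h); split.
- by move=> x Cx; apply: cvgN; exact: ch.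
- move=> x; rewrite /= (_ : _ - _ = - (K (t, x) - K (s, x) - h x)); last by ring.
  by rewrite rpredN.
- by move=> x y xy /=; rewrite (eh _ _ xy).
Qed.

Lemma lift_step_trans s t r : lift_step s t -> lift_step t r -> lift_step s r.
Proof.
move=> [h [ch hh eh]] [k [ck hk ek]]; exists (h \+ k); split.
- by move=> x Cx; apply: cvgD; [exact: ch|exact: ck].
- move=> x; rewrite /= (_ : _ - _ =
    (K (t, x) - K (s, x) - h x) + (K (r, x) - K (t, x) - k x)); last by ring.
  by rewrite rpredD.
- by move=> x y xy /=; rewrite (eh _ _ xy) (ek _ _ xy).
Qed.

(** By compactness of [C], for [t] close to [s] the value of [K] moves by less
than 1/2 at all points of [C] simultaneously; the variation can then be lifted
by [cres]. *)
Lemma lift_step_near s : \forall t \near s, lift_step s t.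
Proof.
have e0 : 0 < 8^-1 :> R by lra.
have H : \forall t \near s,
    C `<=` [set x | `|cres (K (t, x) - K (s, x))| < 2^-1].
  have /compact_near_coveringP nC := cC.
  apply: (nC R (nbhs s)
    (fun t x => `|cres (K (t, x) - K (s, x))| < 2^-1)) => x Cx.
  have [[U V] /= [sU xV] UV] := cK (s, x) e0.
  exists (V, U); first by [].
  move=> [y t] /= [Vy Ut].
  have h1 := UV (t, y) (conj Ut Vy).
  have h2 := UV (s, y) (conj (nbhs_singleton sU) Vy).
  rewrite (_ : K (t, y) - K (s, y) =
    (K (t, y) - K (s, x)) + - (K (s, y) - K (s, x))); last by ring.
  apply: le_lt_trans (norm_cresD _ _) _; rewrite norm_cresN.
  move: h1 h2 => /=; lra.
apply: filterS H => t Ht.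
exists (fun x => cres (K (t, x) - K (s, x))); split.
- move=> x Cx.
  apply: (@continuous_cres R X (fun x => K (t, x) - K (s, x))); last exact: Ht.
  have cKt r : circle_cvg (fun x => K (r, x)) x.
    apply: (@circle_cvg_comp R X _ K (fun x => (r, x))) => //.
    by apply: continuous_pair; [exact: cvg_cst|exact: cvg_id].
  by apply: circle_cvgD => //; exact: circle_cvgN.
- by move=> x; exact: subr_cres_int.
- move=> x y xy; apply: cres_eq.
  rewrite (_ : _ - _ = (K (t, x) - K (t, y)) - (K (s, x) - K (s, y))); last by ring.
  by rewrite rpredB.
Qed.

Lemma homotopy_lift s t : lift_step s t.
Proof.
apply: locally_constant_rel; first exact: lift_step_sym.
- exact: lift_step_trans.
- exact: lift_step_near.
Qed.

End HomotopyLifting.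

(** * Degree of loops in the circle *)

Section Clamp.
Variable R : realType.

(** The retraction of the line onto [0, 1]: it allows paths and homotopies
parametrised by [0, 1] to be replaced by ones defined on the whole line. *)
Definition clamp (t : R) : R := Num.max 0 (Num.min 1 t).

Lemma clamp_itv t : 0 <= clamp t <= 1.
Proof.
by rewrite /clamp; case: (lerP 1 t) => ?;
  [case: (lerP (0 : R) 1)|case: (lerP 0 t)] => ?; lra.
Qed.

Lemma clamp_id t : 0 <= t <= 1 -> clamp t = t.
Proof.
by move=> *; rewrite /clamp; case: (lerP 1 t) => ?;
  [case: (lerP (0 : R) 1)|case: (lerP 0 t)] => ?; lra.
Qed.

Lemma clamp_le0 t : t <= 0 -> clamp t = 0.
Proof.
by move=> *; rewrite /clamp; case: (lerP 1 t) => ?;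
  [case: (lerP (0 : R) 1)|case: (lerP 0 t)] => ?; lra.
Qed.

Lemma clamp_ge1 t : 1 <= t -> clamp t = 1.
Proof.
by move=> *; rewrite /clamp; case: (lerP 1 t) => ?;
  [case: (lerP (0 : R) 1)|case: (lerP 0 t)] => ?; lra.
Qed.

Lemma clamp0 : clamp 0 = 0. Proof. exact: clamp_le0. Qed.

Lemma clamp1 : clamp 1 = 1. Proof. exact: clamp_ge1. Qed.

Lemma clamp_convex (a b x y : R) t :
  a < x < b -> a < y < b -> a < x + clamp t * (y - x) < b.
Proof.
have := clamp_itv t; move: (clamp t) => c c01 hx hy.
by case: (lerP x y) => xy; apply/andP; split; nra.
Qed.

Lemma continuous_clamp : continuous clamp.
Proof.
move=> t; apply: (@continuous_max R R (cst 0) (Num.min 1)); first exact: cvg_cst.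
by apply: (@continuous_min R R (cst 1) id); [exact: cvg_cst|exact: cvg_id].
Qed.

End Clamp.

Section Degree.
Variable R : realType.
Implicit Types (u v a : R -> R) (m n : int).

(** The number of turns of a path in the circle over [0, 1], read off a lift
[a].  It is used only for paths that close up modulo 1. *)
Definition degree u n : Prop := exists a : R -> R,
  [/\ continuous a, forall t, 0 <= t <= 1 -> u t - a t \is a Num.int &
      a 1 - a 0 = n%:~R].

Lemma continuous_int_valued_cst u s t :
  continuous u -> (forall r, u r \is a Num.int) -> u s = u t.
Proof.
move=> cu iu; move: s t; apply: locally_constant_rel => //.
- by move=> s t r -> ->.
- move=> s; have := cvg_circle (cu s).
  move: (cu s) => /cvgr_dist_lt/(_ 2^-1) H _.
  have e0 : 0 < 2^-1 :> R by lra.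
  apply: filterS (H e0) => t h.
  have : cres (u s - u t) = u s - u t.
    by move: h; rewrite ltr_norml => h; rewrite cres_id//; lra.
  by rewrite cres_int ?rpredB// => /esym/eqP; rewrite subr_eq0 => /eqP.
Qed.

Lemma degree_uniq u m n : degree u m -> degree u n -> m = n.
Proof.
move=> [a [ca ua am]] [b [cb ub bn]].
have : a (clamp 1) - b (clamp 1) = a (clamp 0) - b (clamp 0).
  apply: (@continuous_int_valued_cst (fun t => a (clamp t) - b (clamp t))).
    move=> t; apply: cvgB; apply: continuous_comp; first exact: continuous_clamp.
    - exact: ca.
    - exact: continuous_clamp.
    - exact: cb.
  move=> t; rewrite (_ : _ - _ = (u (clamp t) - b (clamp t)) -
    (u (clamp t) - a (clamp t))); last by ring.
  by rewrite rpredB ?ua ?ub// clamp_itv.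
rewrite clamp0 clamp1 => h; apply: (@intr_inj R).
by rewrite -am -bn; lra.
Qed.

Lemma degreeD u v m n : degree u m -> degree v n -> degree (u \+ v) (m + n).
Proof.
move=> [a [ca ua am]] [b [cb vb bn]]; exists (a \+ b); split.
- by move=> t; apply: cvgD; [exact: ca|exact: cb].
- by move=> t t01 /=; rewrite opprD addrACA rpredD ?ua ?vb.
- by rewrite /= intrD -am -bn; ring.
Qed.

Lemma degree_cst c : degree (cst c) 0.
Proof.
exists (cst c); split; first by move=> t; exact: cvg_cst.
- by move=> t _; rewrite subrr rpred0.
- by rewrite subrr mulr0z.
Qed.

Lemma degree_eqmod u v n :
  (forall t, 0 <= t <= 1 -> u t - v t \is a Num.int) -> degree u n -> degree v n.
Proof.
move=> uv [a [ca ua an]]; exists a; split => // t t01.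
rewrite (_ : _ - _ = (u t - a t) - (u t - v t)); last by ring.
by rewrite rpredB ?ua ?uv.
Qed.

Lemma degree_eq u v n :
  (forall t, 0 <= t <= 1 -> u t = v t) -> degree u n -> degree v n.
Proof. by move=> uv; apply: degree_eqmod => t /uv ->; rewrite subrr rpred0. Qed.

Lemma degreeMn u n d : degree u n -> degree (fun t => u t *+ d) (n *+ d).
Proof.
move=> un; elim: d => [|d IH].
  by rewrite mulr0n; exact: degree_eq (degree_cst 0).
by rewrite mulrS; apply: degree_eq (degreeD un IH) => t _ /=; rewrite mulrS.
Qed.

(** The lift of the variation of [K] takes the same value at 0 and at 1, because
these two points trace the same path in the circle. *)
Lemma degree_homotopy (K : R * R -> R) n : circle_continuous K ->
  (forall s, K (s, 1) - K (s, 0) \is a Num.int) ->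
  degree (fun t => K (0, t)) n -> degree (fun t => K (1, t)) n.
Proof.
move=> cK K01 [a [ca Ka an]].
have [h [ch Kh eh]] := homotopy_lift (@segment_compact R 0 1) cK 0 1.
exists (fun t => a t + h (clamp t)); split.
- move=> t; apply: cvgD; first exact: ca.
  apply: (@continuous_comp _ _ _ (@clamp R) h); first exact: continuous_clamp.
  by apply: ch; rewrite /= in_itv/=; exact: clamp_itv.
- move=> t t01; rewrite clamp_id// (_ : _ - _ =
    (K (0, t) - a t) + (K (1, t) - K (0, t) - h t)); last by ring.
  by rewrite rpredD ?Ka.
- by rewrite clamp0 clamp1 (eh 1 0)// -an; ring.
Qed.

(** A path is contracted to its origin by [K (s, t) = u (s t)], and a constant
path has an obvious lift. *)
Lemma degree_exists u :
  circle_continuous u -> u 1 - u 0 \is a Num.int -> exists n, degree u n.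
Proof.
move=> cu u01; pose K (p : R * R) := u (p.1 * p.2).
have cK : circle_continuous K.
  move=> p; apply: (@circle_cvg_comp R _ _ u (fun p : R * R => p.1 * p.2)) => //.
  by apply: cvgM; [exact: cvg_fst|exact: cvg_snd].
have [h [ch Kh _]] := homotopy_lift (@segment_compact R 0 1) cK 0 1.
have ua t : u t - (u 0 + h t) \is a Num.int.
  by have := Kh t; rewrite /K /= mul1r mul0r opprD addrA.
have /intrP[n hn] : h 1 - h 0 \is a Num.int.
  rewrite (_ : _ - _ = (u 1 - u 0) - (u 1 - (u 0 + h 1)) +
    (u 0 - (u 0 + h 0))); last by ring.
  by rewrite rpredD// rpredB.
exists n, (fun t => u 0 + h (clamp t)); split.
- move=> t; apply: cvgD; first exact: cvg_cst.
  apply: (@continuous_comp _ _ _ (@clamp R) h); first exact: continuous_clamp.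
  by apply: ch; rewrite /= in_itv/=; exact: clamp_itv.
- by move=> t t01; rewrite clamp_id.
- by rewrite clamp0 clamp1 -hn; ring.
Qed.

End Degree.

(** * Angles in the plane *)

Section Angle.
Variable R : realType.
Implicit Types (a e r t : R) (v w : R * R) (c p : plane R).

Lemma cos_sin_turn_int t n : n \is a Num.int ->
  cos (2 * pi * (t + n)) = cos (2 * pi * t) /\
  sin (2 * pi * (t + n)) = sin (2 * pi * t).
Proof.
have P (x : R) (m : nat) :
    cos (x + pi *+ 2 *+ m) = cos x /\ sin (x + pi *+ 2 *+ m) = sin x.
  elim: m => [|m [IHc IHs]]; first by rewrite mulr0n addr0.
  by rewrite mulrSr addrA cosD2pi sinD2pi.
move=> /intrP[[m|m] ->].
- have := P (2 * pi * t) m.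
  by rewrite (_ : 2 * pi * (t + _) = 2 * pi * t + pi *+ 2 *+ m) // -pmulrn; ring.
- have [<- <-] := P (2 * pi * (t + (Negz m)%:~R)) m.+1.
  rewrite NegzE mulrNz -pmulrn.
  by split; congr (_ _); ring.
Qed.

Lemma cos_turn_cres a : cos (2 * pi * a) = cos (2 * pi * `|cres a|).
Proof.
have := (cos_sin_turn_int (cres a) (subr_cres_int a)).1.
rewrite addrC subrK => ->.
by case: (ger0P (cres a)) => [//|_]; rewrite mulrN cosN.
Qed.

Let halfturn a : 0 <= a <= 2^-1 -> 2 * pi * a \in `[0, (pi : R)].
Proof.
have p0 := pi_gt0 R; move=> ha; rewrite in_itv /=; apply/andP; split; nra.
Qed.

Let cres_half a : 0 <= `|cres a| <= 2^-1.
Proof. by have := cres_itv a; rewrite normr_ge0 ler_norml /=; lra. Qed.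

(** The cosine of [2 pi a] controls the distance from [a] to the integers; this
replaces the choice of branches of an inverse trigonometric function. *)
Lemma norm_cres_lt_cos a e : 0 <= e <= 2^-1 ->
  cos (2 * pi * e) < cos (2 * pi * a) -> `|cres a| < e.
Proof.
move=> he; rewrite (cos_turn_cres a) ltr_cos ?halfturn//.
by rewrite ltr_pM2l ?mulr_gt0 ?pi_gt0.
Qed.

Lemma cos_turn_eq1 a : cos (2 * pi * a) = 1 -> a \is a Num.int.
Proof.
rewrite cos_turn_cres -[RHS](cos0 R) => h.
have z0 : (0 : R) \in `[0, pi] by rewrite in_itv/= lexx pi_ge0.
have /eqP := cos_inj (halfturn (cres_half a)) z0 h.
rewrite mulf_eq0 mulf_eq0 pnatr_eq0 (gt_eqF (pi_gt0 R)) /= normr_eq0 => /eqP a0.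
by have := subr_cres_int a; rewrite a0 subr0.
Qed.

Lemma unit_circle_turn (x y : R) : x ^+ 2 + y ^+ 2 = 1 ->
  exists t, x = cos (2 * pi * t) /\ y = sin (2 * pi * t).
Proof.
move=> xy1; have x1 : -1 <= x <= 1 by nra.
have E s : 2 * pi * (s / (2 * pi)) = s :> R.
  by rewrite mulrC divfK// mulf_neq0// gt_eqF// pi_gt0.
have sy : sin (acos x) = `|y|.
  by rewrite sin_acos// -xy1 addrC addKr sqrtr_sqr.
case: (lerP 0 y) => y0.
- exists (acos x / (2 * pi)); rewrite E sy ger0_norm//.
  by rewrite acosK// in_itv.
- exists (- acos x / (2 * pi)); rewrite E cosN sinN sy ltr0_norm// opprK.
  by rewrite acosK// in_itv.
Qed.

Definition vnorm v : R := Num.sqrt (v.1 ^+ 2 + v.2 ^+ 2).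

(** Angles are measured in turns.  Any choice of the angle will do, since only its
class modulo 1 is used; no branch is specified. *)
Definition angle v : R := xget 0 [set t : R |
  v.1 = vnorm v * cos (2 * pi * t) /\ v.2 = vnorm v * sin (2 * pi * t)].

Lemma vnorm_ge0 v : 0 <= vnorm v. Proof. exact: sqrtr_ge0. Qed.

Lemma sqr_vnorm v : vnorm v ^+ 2 = v.1 ^+ 2 + v.2 ^+ 2.
Proof. by rewrite sqr_sqrtr// addr_ge0// sqr_ge0. Qed.

Lemma vnorm_gt0 v : v != 0 -> 0 < vnorm v.
Proof.
move=> v0; rewrite lt_neqAle vnorm_ge0 andbT; apply: contra v0 => /eqP n0.
have := sqr_vnorm v; rewrite -n0 expr0n /= => /esym/eqP.
by rewrite paddr_eq0 ?sqr_ge0// !sqrf_eq0 => /andP[/eqP h1 /eqP h2];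
  rewrite [v]surjective_pairing h1 h2.
Qed.

Lemma angleP v :
  v.1 = vnorm v * cos (2 * pi * angle v) /\
  v.2 = vnorm v * sin (2 * pi * angle v).
Proof.
suff [t ht] : exists t, [set t : R |
  v.1 = vnorm v * cos (2 * pi * t) /\ v.2 = vnorm v * sin (2 * pi * t)] t.
  exact: (@xgetPex _ 0 _ (ex_intro _ t ht)).
have [->|v0] := eqVneq v 0.
  by exists 0; rewrite /= /vnorm /= expr0n addr0 sqrtr0 !mul0r.
have n0 := gt_eqF (vnorm_gt0 v0).
have [t [ct st]] : exists t, v.1 / vnorm v = cos (2 * pi * t) /\
    v.2 / vnorm v = sin (2 * pi * t).
  apply: unit_circle_turn; rewrite !expr_div_n -mulrDl -sqr_vnorm divff//.
  by rewrite sqrf_eq0 n0.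
by exists t => /=; rewrite -ct -st !mulrA ![vnorm v * _]mulrC !mulfK ?n0.
Qed.

Lemma vnorm_polar r t : 0 <= r ->
  vnorm (r * cos (2 * pi * t), r * sin (2 * pi * t)) = r.
Proof.
move=> r0; rewrite /vnorm /= !exprMn -mulrDr cos2Dsin2 mulr1 sqrtr_sqr.
exact: ger0_norm.
Qed.

(** The expression of the cosine of an angle by the inner product: it is
continuous in both vectors, which gives the continuity of [angle] modulo 1. *)
Lemma cos_angleB v w : v != 0 -> w != 0 ->
  cos (2 * pi * (angle w - angle v)) =
  (v.1 * w.1 + v.2 * w.2) / (vnorm v * vnorm w).
Proof.
move=> v0 w0; have [v1 v2] := angleP v; have [w1 w2] := angleP w.
rewrite mulrBr cosB v1 v2 w1 w2.
have := vnorm_gt0 v0; have := vnorm_gt0 w0.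
move: (vnorm v) (vnorm w) (cos _) (sin _) (cos _) (sin _) => n m cw sw cv sv m0 n0.
by field; rewrite !gt_eqF.
Qed.

Lemma angle_polar r t : 0 < r ->
  angle (r * cos (2 * pi * t), r * sin (2 * pi * t)) - t \is a Num.int.
Proof.
move=> r0; set v := (_, _).
have [] := angleP v; rewrite vnorm_polar ?ltW//= => h1 h2.
have r00 := gt_eqF r0.
have {}h1 := mulfI (negbT r00) h1; have {}h2 := mulfI (negbT r00) h2.
apply: cos_turn_eq1; rewrite mulrBr cosB -h1 -h2 -!expr2.
exact: cos2Dsin2.
Qed.

Lemma continuous_vnorm : continuous vnorm.
Proof.
move=> v; apply: (@continuous_comp _ _ _ (fun v => v.1 ^+ 2 + v.2 ^+ 2) Num.sqrt);
  last exact: sqrt_continuous.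
by apply: cvgD; apply: cvgM; (exact: cvg_fst || exact: cvg_snd).
Qed.

Lemma circle_cvg_angle v : v != 0 -> circle_cvg angle v.
Proof.
move=> v0 e e0.
(* The cosine is injective only on half a turn, hence the bound on [d]. *)
pose d := Num.min e 4^-1; have d0 : 0 < d by rewrite /d lt_min; apply/andP; split; lra.
have d4 : 0 <= d <= 2^-1 by rewrite ltW//= /d ge_min; apply/orP; right; lra.
have cd : cos (2 * pi * d) < 1.
  rewrite -[ltRHS](cos0 R) ltr_cos ?halfturn// ?in_itv/= ?lexx ?pi_ge0//.
  by rewrite !mulr_gt0// pi_gt0.
pose F w := (v.1 * w.1 + v.2 * w.2) / (vnorm v * vnorm w).
have cF : {for v, continuous F}.
  apply: cvgM.
    by apply: cvgD; apply: cvgM;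
      (exact: cvg_cst || exact: cvg_fst || exact: cvg_snd).
  apply: cvgV; first by rewrite mulf_neq0// gt_eqF// vnorm_gt0.
  by apply: cvgM; [exact: cvg_cst|exact: continuous_vnorm].
have Fv : F v = 1.
  by rewrite /F -!expr2 -sqr_vnorm divff// sqrf_eq0 gt_eqF// vnorm_gt0.
near=> w.
have w0 : w != 0.
  near: w; move: (continuous_vnorm (x := v)) => /cvgr_gt.
  move=> /(_ 0 (vnorm_gt0 v0)); apply: filterS => w; apply: contraTneq => ->.
  by rewrite /vnorm /= expr0n addr0 sqrtr0 ltxx.
apply: (@lt_le_trans _ _ d); last by rewrite /d ge_min lexx.
apply: norm_cres_lt_cos => //; rewrite cos_angleB// -/(F w).
near: w; apply: (cvgr_gt _ cF); rewrite Fv//.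
Unshelve. all: by end_near. Qed.

End Angle.

(** * Polar coordinates and inverses of charts *)

Section PolarCoordinates.
Variable R : realType.
Implicit Types (c p : plane R) (r t : R).

Definition dvec c p : R * R := (p.1 - c.1, p.2 - c.2).
Definition radius c p : R := vnorm (dvec c p).
Definition turn c p : R := angle (dvec c p).

Lemma polar_radius_turn c p : polar c (radius c p) (turn c p) = p.
Proof.
have [h1 h2] := angleP (dvec c p).
by rewrite /polar -h1 -h2 /= ![_ + (_ - _)]addrC !subrK -surjective_pairing.
Qed.

Lemma dvec_polar c r t :
  dvec c (polar c r t) = (r * cos (2 * pi * t), r * sin (2 * pi * t)).
Proof. by rewrite /dvec /polar /= ![c.1 + _]addrC ![c.2 + _]addrC !addrK. Qed.

Lemma radius_polar c r t : 0 <= r -> radius c (polar c r t) = r.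
Proof. by move=> r0; rewrite /radius dvec_polar vnorm_polar. Qed.

Lemma turn_polar c r t : 0 < r -> turn c (polar c r t) - t \is a Num.int.
Proof. by move=> r0; rewrite /turn dvec_polar angle_polar. Qed.

Lemma dvec_neq0 c p : p <> c -> dvec c p != 0.
Proof.
move=> pc; apply/eqP => -[] /eqP; rewrite subr_eq0 => /eqP h1.
move=> /eqP; rewrite subr_eq0 => /eqP h2; apply: pc.
by rewrite [p]surjective_pairing h1 h2 -surjective_pairing.
Qed.

Lemma radius_gt0 c p : p <> c -> 0 < radius c p.
Proof. by move=> /dvec_neq0; exact: vnorm_gt0. Qed.

Lemma polar_neq c r t : 0 < r -> polar c r t <> c.
Proof.
move=> r0 h; have := radius_polar c t (ltW r0); rewrite h /radius /dvec !subrr.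
by rewrite /vnorm /= expr0n addr0 sqrtr0 => h0; rewrite h0 ltxx in r0.
Qed.

Lemma polar_turn_int c r t t' : t - t' \is a Num.int -> polar c r t = polar c r t'.
Proof.
move=> h; have [h1 h2] := cos_sin_turn_int t' h.
by rewrite addrC subrK in h1 h2; rewrite /polar h1 h2.
Qed.

Lemma polar_box c r t :
  `|(polar c r t).1 - c.1| <= `|r| /\ `|(polar c r t).2 - c.2| <= `|r|.
Proof.
rewrite /polar /= ![c.1 + _]addrC ![c.2 + _]addrC !addrK !normrM.
by rewrite !ler_piMr// ?cos_max ?sin_max.
Qed.

Lemma radius_box c p : `|p.1 - c.1| <= radius c p /\ `|p.2 - c.2| <= radius c p.
Proof.
have := polar_box c (radius c p) (turn c p).
by rewrite polar_radius_turn (ger0_norm (vnorm_ge0 _)).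
Qed.

Variable Z : topologicalType.
Implicit Types (z : Z).

Lemma continuous_polar (c : Z -> plane R) (r t : Z -> R) z :
  {for z, continuous c} -> {for z, continuous r} -> {for z, continuous t} ->
  {for z, continuous (fun z => polar (c z) (r z) (t z))}.
Proof.
move=> cc cr ct.
have c1 : {for z, continuous (fun z => (c z).1)}.
  by apply: (@continuous_comp _ _ _ c fst); [exact: cc|exact: cvg_fst].
have c2 : {for z, continuous (fun z => (c z).2)}.
  by apply: (@continuous_comp _ _ _ c snd); [exact: cc|exact: cvg_snd].
have ct' : {for z, continuous (fun z => 2 * pi * t z)}.
  by apply: cvgM => //; exact: cvg_cst.
apply: continuous_pair; apply: cvgD => //; apply: cvgM => //.
- apply: (@continuous_comp _ _ _ (fun z => 2 * pi * t z) (@cos R)) => //.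
  exact: continuous_cos.
- apply: (@continuous_comp _ _ _ (fun z => 2 * pi * t z) (@sin R)) => //.
  exact: continuous_sin.
Qed.

Lemma continuous_dvec (c p : Z -> plane R) z :
  {for z, continuous c} -> {for z, continuous p} ->
  {for z, continuous (fun z => dvec (c z) (p z))}.
Proof.
move=> cc cp; apply: continuous_pair; apply: cvgB.
- by apply: (@continuous_comp _ _ _ p fst); [exact: cp|exact: cvg_fst].
- by apply: (@continuous_comp _ _ _ c fst); [exact: cc|exact: cvg_fst].
- by apply: (@continuous_comp _ _ _ p snd); [exact: cp|exact: cvg_snd].
- by apply: (@continuous_comp _ _ _ c snd); [exact: cc|exact: cvg_snd].
Qed.

Lemma continuous_radius (c p : Z -> plane R) z :
  {for z, continuous c} -> {for z, continuous p} ->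
  {for z, continuous (fun z => radius (c z) (p z))}.
Proof.
move=> cc cp; apply: (@continuous_comp _ _ _ (fun z => dvec (c z) (p z)) (@vnorm R)).
  exact: continuous_dvec.
exact: continuous_vnorm.
Qed.

Lemma circle_cvg_turn (c p : Z -> plane R) z :
  {for z, continuous c} -> {for z, continuous p} -> p z <> c z ->
  circle_cvg (fun z => turn (c z) (p z)) z.
Proof.
move=> cc cp pc; apply: (@circle_cvg_comp _ _ _ (@angle R) (fun z => dvec (c z) (p z))).
  exact: continuous_dvec.
exact/circle_cvg_angle/dvec_neq0.
Qed.

End PolarCoordinates.

Section ChartInverse.
Variables (R : realType) (S : topologicalType) (psi : plane R -> S).
Hypothesis psi_chart : is_chart psi.

Definition chart_inv (x : S) : plane R := xget ((0, 0) : R * R) [set p | psi p = x].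

Lemma chart_invK : cancel psi chart_inv.
Proof.
move=> p; have [_ psi_inj _] := psi_chart; apply: psi_inj.
exact: (@xgetPex _ _ [set q | psi q = psi p] (ex_intro _ p erefl)).
Qed.

Lemma chart_invP x : range psi x -> psi (chart_inv x) = x.
Proof. by move=> [p _ <-]; rewrite chart_invK. Qed.

Lemma continuous_chart_inv x : range psi x -> {for x, continuous chart_inv}.
Proof.
move=> [p _ <-] V; rewrite chart_invK nbhsE => -[W [oW Wp] WV].
have [_ _ /(_ _ oW) opsi] := psi_chart.
apply: (@filterS _ (nbhs (psi p)) _ (psi @` W)).
  by move=> _ [q Wq <-] /=; apply: WV; rewrite chart_invK.
by apply: open_nbhs_nbhs; split => //; exists p.
Qed.

Lemma range_chart_nbhs x : range psi x -> nbhs x (range psi).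
Proof.
move=> xpsi; have [_ _ opsi] := psi_chart.
by apply: open_nbhs_nbhs; split => //; apply: opsi; exact: openT.
Qed.

End ChartInverse.

(** * Isotopies preserve orientation *)

Section PositiveGerms.
Variables (R : realType) (S : topologicalType).
Implicit Types (p q : plane R) (f psi : plane R -> S).

(** The condition on a single circle in [positive_transition], for a map [f]
that need not be a chart: in the chart [psi], [f] maps the circle of radius
[r] around [p] to a loop that winds once around [q]. *)
Definition positive_circle f p psi q (r : R) : Prop := exists rho theta : R -> R,
  [/\ {within `[0, 1], continuous rho},
      {within `[0, 1], continuous theta},
      theta 1 = theta 0 + 1 &
      forall t : R, t \in `[0, 1] ->
        0 < rho t /\ f (polar p r t) = psi (polar q (rho t) (theta t))].

Lemma continuous_comp_clamp (u : R -> R) :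
  {within `[0, 1], continuous u} -> continuous (u \o @clamp R).
Proof.
move=> /subspace_continuousP cu t.
have h : `[0, 1]%classic (clamp t) by rewrite /= in_itv /= clamp_itv.
apply: cvg_comp (cu _ h) => A; rewrite /nbhs /= /within /= => H.
apply: (@filterS _ (nbhs t) _ _ _ _ (@continuous_clamp R t _ H)) => s /=.
by apply; rewrite in_itv /= clamp_itv.
Qed.

(** This lemma and [degree_positive_circle] translate between the explicit polar
coordinates of the definition of an orientation and the degree. *)
Lemma positive_circle_degree f p psi q r : is_chart psi ->
  positive_circle f p psi q r ->
  degree (fun t => turn q (chart_inv psi (f (polar p r t)))) 1.
Proof.
move=> cpsi [rho [theta [_ ctheta theta1 H]]].
exists (theta \o @clamp R); split.
- exact: continuous_comp_clamp.
- move=> t t01; have [r0 ->] := H t t01; rewrite chart_invK//= clamp_id//.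
  exact: turn_polar.
- by rewrite /= clamp0 clamp1 theta1 addrC addKr mulr1z.
Qed.

Lemma degree_positive_circle f p psi q r (w : R -> plane R) :
  continuous w -> (forall t, w t <> q) ->
  (forall t, 0 <= t <= 1 -> f (polar p r t) = psi (w t)) ->
  degree (fun t => turn q (w t)) 1 -> positive_circle f p psi q r.
Proof.
move=> cw wq fw [a [ca wa a1]]; exists (fun t => radius q (w t)), a; split.
- apply: continuous_subspaceT => t.
  by apply: continuous_radius; [exact: cvg_cst|exact: cw].
- exact: continuous_subspaceT.
- by move: a1 => /eqP; rewrite mulr1z subr_eq addrC => /eqP.
- move=> t t01; split; first exact/radius_gt0/wq.
  rewrite fw// -{1}(polar_radius_turn q (w t)); congr psi.
  apply: polar_turn_int; exact: wa.
Qed.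

End PositiveGerms.

Lemma nbhs_box (R : realType) (p : plane R) (P : plane R -> Prop) :
  nbhs p P -> exists2 d : R, 0 < d &
    forall v, `|v.1 - p.1| < d -> `|v.2 - p.2| < d -> P v.
Proof.
move=> H; have [e e0 he] := (@nbhs_ballP R (R * R)%type p P).1 H.
exists e => // v h1 h2.
by apply: he; split => /=; rewrite -ball_normE /= distrC.
Qed.

Lemma nbhs_interval_box (R : realType) (s : R) (p : plane R)
    (P : R * plane R -> Prop) : nbhs (s, p) P ->
  exists2 d : R, 0 < d & forall t v,
    `|t - s| < d -> `|v.1 - p.1| < d -> `|v.2 - p.2| < d -> P (t, v).
Proof.
move=> [[A B] /= [sA pB] AB].
have [d d0 dB] := nbhs_box pB; have [e e0 eA] := (@nbhs_ballP R R s A).1 sA.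
exists (Num.min d e); first by rewrite lt_min d0.
move=> t v; rewrite !lt_min => /andP[_ h] /andP[h1 _] /andP[h2 _].
apply: AB; split => /=; last exact: dB.
by apply: eA; rewrite -ball_normE /= distrC.
Qed.

(** Let [f (s, _)] be a continuous family of maps from a neighbourhood of [p] to
the surface that take the value [f (s, p)] at [p] only.  Whether [f (s, _)]
preserves the orientation at [p] does not depend on [s]. *)
Section IsotopyPositive.
Variables (R : realType) (S : topologicalType) (o : orientation R S).
Variables (f : R * plane R -> S) (p : plane R) (U : plane R -> Prop).
Hypothesis nU : nbhs p U.
Hypothesis cf : forall s v, U v -> {for (s, v), continuous f}.
Hypothesis inj_f : forall s v, U v -> f (s, v) = f (s, p) -> v = p.

Let positive (s : R) : Prop :=
  forall psi q, oriented_charts o psi -> f (s, p) = psi q ->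
  \forall r \near 0^'+, positive_circle (fun v => f (s, v)) p psi q r.

Let Up : U p := nbhs_singleton nU.

Section LocalChart.
Variables (s0 d : R) (chi : plane R -> S).
Hypotheses (d0 : 0 < d) (ochi : oriented_charts o chi).
Hypothesis fchi : forall s v, `|s - s0| < d -> `|v.1 - p.1| < d ->
  `|v.2 - p.2| < d -> U v /\ range chi (f (s, v)).

Let cchi : is_chart chi := oriented_chartP ochi.
Let g (x : R * plane R) : plane R := chart_inv chi (f x).

Let small (x : R * plane R) : Prop :=
  [/\ `|x.1 - s0| < d, `|x.2.1 - p.1| < d & `|x.2.2 - p.2| < d].

Let cg x : small x -> {for x, continuous g}.
Proof.
case: x => s v [/= h h1 h2]; have [Uv fv] := fchi h h1 h2.
apply: (@continuous_comp _ _ _ f (chart_inv chi)); first exact: cf.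
exact: continuous_chart_inv.
Qed.

Let gK x : small x -> chi (g x) = f x.
Proof.
case: x => s v [/= h h1 h2]; have [_ fv] := fchi h h1 h2.
exact: chart_invP.
Qed.

Let small_center s : `|s - s0| < d -> small (s, p).
Proof. by move=> h; split => //=; rewrite subrr normr0. Qed.

Let small_polar s r t : `|s - s0| < d -> `|r| < d -> small (s, polar p r t).
Proof.
move=> h hr; have [h1 h2] := polar_box p r t.
by split => //=; apply: le_lt_trans hr.
Qed.

Let g_neq s v : small (s, v) -> v <> p -> g (s, v) <> g (s, p).
Proof.
move=> sv vp gvp; apply: vp.
have [/= h h1 h2] := sv; have [Uv _] := fchi h h1 h2.
apply: (@inj_f s) => //.
by rewrite -(gK sv) gvp (gK (small_center h)).
Qed.

(** The image of a small circle around [p], as seen in the chart [chi], where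
[s] stays so close to [s0] that this single chart contains all these images. *)
Let loop s r t : R := turn (g (s, p)) (g (s, polar p r t)).

(** Two such loops are joined by moving the time and the radius linearly; along
the way the loop avoids its centre. *)
Let loop_degree s s' r r' : `|s - s0| < d -> `|s' - s0| < d ->
  0 < r < d -> 0 < r' < d -> degree (loop s r) 1 -> degree (loop s' r') 1.
Proof.
move=> hs hs' hr hr' H.
pose ss (x : R * R) := s + clamp x.1 * (s' - s).
pose rr (x : R * R) := r + clamp x.1 * (r' - r).
have hss x : `|ss x - s0| < d.
  move: hs hs'; rewrite !ltr_norml => h h'.
  rewrite /ss addrAC (_ : s' - s = (s' - s0) - (s - s0)); last by ring.
  exact: clamp_convex.
have hrr x : 0 < rr x < d by exact: clamp_convex.
have hrr' x : `|rr x| < d by case/andP: (hrr x) => h ?; rewrite gtr0_norm.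
have ccl (x : R * R) : {for x, continuous (fun x : R * R => clamp x.1)}.
  apply: (@continuous_comp _ _ _ fst (@clamp R)); first exact: cvg_fst.
  exact: continuous_clamp.
have css : continuous ss.
  by move=> x; apply: cvgD; [exact: cvg_cst|apply: cvgM; [exact: ccl|exact: cvg_cst]].
have crr : continuous rr.
  by move=> x; apply: cvgD; [exact: cvg_cst|apply: cvgM; [exact: ccl|exact: cvg_cst]].
suff : degree (fun t => loop (ss (1, t)) (rr (1, t)) t) 1.
  by rewrite /ss /rr /= clamp1 !mul1r ![_ + (_ - _)]addrC !subrK.
apply: (@degree_homotopy R (fun x => loop (ss x) (rr x) x.2)).
- move=> x.
  apply: (@circle_cvg_turn R _ (fun x => g (ss x, p))
    (fun x => g (ss x, polar p (rr x) x.2))).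
  + apply: (@continuous_comp _ _ _ (fun x => (ss x, p)) g).
      by apply: continuous_pair; [exact: css|exact: cvg_cst].
    exact: cg (small_center _).
  + apply: (@continuous_comp _ _ _ (fun x => (ss x, polar p (rr x) x.2)) g).
      apply: continuous_pair; first exact: css.
      by apply: continuous_polar; [exact: cvg_cst|exact: crr|exact: cvg_snd].
    exact: cg (small_polar _ _ _).
  + apply: g_neq; first exact: small_polar.
    by apply: polar_neq; case/andP: (hrr x).
- move=> t; rewrite /loop (@polar_turn_int R p _ 1 0) ?subr0 ?rpred1//=.
  by rewrite /ss /rr /= subrr rpred0.
- by move: H; rewrite /ss /rr /= clamp0 !mul0r !addr0.
Qed.

(** Since the degree in the fixed chart [chi] is independent of [s] and [r], so
is positivity, as soon as it may be tested in [chi] alone.  For another chart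
[psi] of the orientation this is a chain rule: the loop winds once around its
centre in [chi], so it is homotopic in the punctured disc to a small circle,
and the transition map from [chi] to [psi] is positive on that circle. *)
Let positive_degree s : `|s - s0| < d ->
  positive s <-> degree (loop s0 (d / 2)) 1.
Proof.
have h0 : `|s0 - s0| < d by rewrite subrr normr0.
have hd2 : 0 < d / 2 < d by rewrite divr_gt0//= gtr_pMr//; lra.
move=> hs; split.
- move=> /(_ chi (g (s, p)) ochi); rewrite gK; last exact: small_center.
  move=> /(_ erefl) H.
  have [r [hr rd]] : exists r,
      positive_circle (fun v => f (s, v)) p chi (g (s, p)) r /\ 0 < r < d.
    apply: (@filter_ex _ (0^'+)); near=> r; split; first by near: r.
    by apply/andP; split; near: r; [exact: nbhs_right_gt|exact: nbhs_right_lt].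
  apply: (loop_degree hs h0 rd hd2).
  exact: (positive_circle_degree cchi hr).
- move=> Q psi q opsi fq.
  have cpsi := oriented_chartP opsi.
  pose q1 := g (s, p).
  have q1E : chi q1 = psi q by rewrite gK//; exact: small_center.
  have cchiv v : {for v, continuous chi} by have [c _ _] := cchi; exact: c.
  have [d1 d10 hd1] : exists2 d1 : R, 0 < d1 & forall v,
      `|v.1 - q1.1| < d1 -> `|v.2 - q1.2| < d1 -> range psi (chi v).
    apply: nbhs_box; apply: (cchiv q1); apply: range_chart_nbhs => //.
    by rewrite q1E; exists q.
  pose k v := chart_inv psi (chi v).
  have rk v : radius q1 v < d1 -> range psi (chi v).
    by move=> h; have [h1 h2] := radius_box q1 v; apply: hd1; apply: le_lt_trans h.
  have ck v : radius q1 v < d1 -> {for v, continuous k}.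
    move=> h; apply: (@continuous_comp _ _ _ chi (chart_inv psi)) => //.
    exact: continuous_chart_inv (rk _ h).
  have kq v : radius q1 v < d1 -> v <> q1 -> k v <> q.
    move=> h vq1 kv; apply: vq1; have [_ chi_inj _] := cchi; apply: chi_inj.
    by rewrite q1E -kv chart_invP//; exact: rk.
  (* The circle of radius [r1] is the one on which the transition map from
     [chi] to [psi] is known to be positive. *)
  have [r1 [hr1 r1d]] : exists r1, positive_circle chi q1 psi q r1 /\ 0 < r1 < d1.
    apply: (@filter_ex _ (0^'+)); near=> r; split.
      by near: r; exact: (oriented_transition ochi opsi q1E).
    by apply/andP; split; near: r; [exact: nbhs_right_gt|exact: nbhs_right_lt].
  have deg1 := positive_circle_degree cpsi hr1.
  have [d2 d20 hd2'] : exists2 d2 : R, 0 < d2 & forall v,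
      `|v.1 - p.1| < d2 -> `|v.2 - p.2| < d2 -> radius q1 (g (s, v)) < d1.
    apply: (@nbhs_box R p (fun v => radius q1 (g (s, v)) < d1)).
    have : {for p, continuous (fun v => radius q1 (g (s, v)))}.
      apply: continuous_radius; first exact: cvg_cst.
      apply: (@continuous_comp _ _ _ (fun v => (s, v)) g).
        by apply: continuous_pair; [exact: cvg_cst|exact: cvg_id].
      exact: cg (small_center hs).
    move=> /cvgr_lt; apply.
    by rewrite /q1 /radius /dvec !subrr /vnorm /= expr0n addr0 sqrtr0.
  near=> r.
  have rd : 0 < r < d.
    by apply/andP; split; near: r; [exact: nbhs_right_gt|exact: nbhs_right_lt].
  have rd2 : r < d2 by near: r; exact: nbhs_right_lt.
  have rr : `|r| = r by rewrite gtr0_norm//; case/andP: rd.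
  pose w t := g (s, polar p r t).
  have small_w t : small (s, polar p r t).
    by apply: small_polar => //; rewrite rr; case/andP: rd.
  have cw : continuous w.
    move=> t; apply: (@continuous_comp _ _ _ (fun t => (s, polar p r t)) g).
      apply: continuous_pair; first exact: cvg_cst.
      by apply: continuous_polar; [exact: cvg_cst|exact: cvg_cst|exact: cvg_id].
    exact: cg.
  have wd1 t : radius q1 (w t) < d1.
    have [h1 h2] := polar_box p r t; rewrite rr in h1 h2.
    by apply: hd2'; apply: le_lt_trans rd2.
  have wq1 t : w t <> q1 by apply: g_neq => //; apply: polar_neq; case/andP: rd.
  have [a [ca wa a1]] := loop_degree h0 hs hd2 rd Q.
  apply: (@degree_positive_circle R S (fun v => f (s, v)) p psi q r (fun t => k (w t))).
  - by move=> t; apply: (@continuous_comp _ _ _ w k); [exact: cw|exact: ck].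
  - by move=> t; apply: kq.
  - by move=> t _; rewrite /k (chart_invP cpsi (rk _ (wd1 t))) gK.
  (* The homotopy is linear in the polar coordinates around [q1], from the circle
     of radius [r1] to the loop [w]. *)
  pose rho (x : R * R) := r1 + clamp x.1 * (radius q1 (w x.2) - r1).
  pose theta (x : R * R) := x.2 + clamp x.1 * (a x.2 - x.2).
  have hrho x : 0 < rho x < d1.
    by apply: clamp_convex => //; rewrite wd1 radius_gt0//; exact: wq1.
  have ccl (x : R * R) : {for x, continuous (fun x : R * R => clamp x.1)}.
    apply: (@continuous_comp _ _ _ fst (@clamp R)); first exact: cvg_fst.
    exact: continuous_clamp.
  have crho : continuous rho.
    move=> x; apply: cvgD; first exact: cvg_cst.
    apply: cvgM; first exact: ccl.
    apply: cvgB; last exact: cvg_cst.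
    apply: (@continuous_radius R _ (cst q1) (fun x : R * R => w x.2)).
      exact: cvg_cst.
    by apply: (@continuous_comp _ _ _ snd w); [exact: cvg_snd|exact: cw].
  have ctheta : continuous theta.
    move=> x; apply: cvgD; first exact: cvg_snd.
    apply: cvgM; first exact: ccl.
    apply: cvgB; last exact: cvg_snd.
    by apply: (@continuous_comp _ _ _ snd a); [exact: cvg_snd|exact: ca].
  pose K x := turn q (k (polar q1 (rho x) (theta x))).
  have : degree (fun t => K (1, t)) 1.
    apply: degree_homotopy.
    + move=> x; have /andP[rho0 rhod] := hrho x.
      have rE : radius q1 (polar q1 (rho x) (theta x)) < d1 by rewrite radius_polar// ltW.
      apply: (@circle_cvg_turn R _ (cst q) (fun x => k (polar q1 (rho x) (theta x)))).
      * exact: cvg_cst.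
      * apply: (@continuous_comp _ _ _ (fun x => polar q1 (rho x) (theta x)) k);
          last exact: ck.
        by apply: continuous_polar; [exact: cvg_cst|exact: crho|exact: ctheta].
      * by apply: kq => //; exact: polar_neq.
    + move=> t.
      have w01 : w 1 = w 0 by rewrite /w (@polar_turn_int R p r 1 0)// subr0 rpred1.
      have rhoE : rho (t, 1) = rho (t, 0) by rewrite /rho /= w01.
      have h : theta (t, 1) - theta (t, 0) \is a Num.int.
        rewrite /theta /= (_ : _ - _ = 1 + clamp t * ((a 1 - a 0) - 1)); last by ring.
        by rewrite a1 mulr1z subrr mulr0 addr0 rpred1.
      by rewrite /K rhoE (polar_turn_int _ _ h) subrr rpred0.
    + apply: degree_eq deg1 => t _.
      by rewrite /K /rho /theta /= clamp0 !mul0r !addr0.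
  apply: degree_eq => t t01.
  rewrite /K /rho /theta /= clamp1 !mul1r ![_ + (_ - _)]addrC !subrK.
  congr (turn q (k _)).
  rewrite -[RHS](polar_radius_turn q1 (w t)).
  by apply: polar_turn_int; rewrite -opprB rpredN; exact: wa.
Unshelve. all: by end_near. Qed.

Lemma positive_locally_constant s : `|s - s0| < d -> positive s0 <-> positive s.
Proof.
move=> hs; have h0 : `|s0 - s0| < d by rewrite subrr normr0.
have [h1 h2] := positive_degree hs; have [h3 h4] := positive_degree h0.
by split => h; [apply/h2/h3|apply/h4/h1].
Qed.

End LocalChart.

(** Locally in [s] a single chart suffices, and the time axis is connected. *)
Lemma isotopy_positive s t : positive s -> positive t.
Proof.
suff : positive s <-> positive t by case.
move: s t; apply: locally_constant_rel.
- by move=> s t [].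
- by move=> s t r [st ts] [tr rt]; split => [/st|/rt].
move=> s; have [chi [q0 [ochi q0E]]] := oriented_cover o (f (s, p)).
have cchi := oriented_chartP ochi.
have [d d0 hd] : exists2 d : R, 0 < d & forall t v, `|t - s| < d ->
    `|v.1 - p.1| < d -> `|v.2 - p.2| < d -> U v /\ range chi (f (t, v)).
  apply: (@nbhs_interval_box R s p (fun x => U x.2 /\ range chi (f x))).
  apply: filterI.
    by exists (setT, U) => /=; [split => //; exact: filterT|case=> ? ? []].
  have : nbhs (f (s, p)) (range chi).
    by apply: range_chart_nbhs => //; rewrite -q0E; exists q0.
  by move=> H; exact: (@cf s p Up _ H).
near=> t; apply: (positive_locally_constant d0 ochi hd).
by rewrite distrC; near: t; move: (@cvg_id R (nbhs s)) => /cvgr_dist_lt; apply.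
Unshelve. all: by end_near. Qed.

End IsotopyPositive.

(** * The rotation of the inner cylinder and the boundary of the handlebody *)

Section SetType.
Variables (T Z : topologicalType) (A : set T).

Lemma continuous_set_val : continuous (set_val : set_type A -> T).
Proof. exact: initial_continuous. Qed.

(** Continuity of maps into the surface can be checked in the ambient space. *)
Lemma continuous_into_set_type (f : Z -> set_type A) z :
  {for z, continuous (fun z => set_val (f z))} -> {for z, continuous f}.
Proof.
move=> cf V; rewrite nbhsE => -[W [[W' oW' <-] Wz] WV].
apply: (@filterS _ (nbhs z) _ ((fun z => set_val (f z)) @^-1` W')).
  by move=> y W'y; apply: WV.
by apply: cf; exact: open_nbhs_nbhs.
Qed.

End SetType.

Section Spin.
Variable R : realType.
Implicit Types (a b : R) (p q : Defs.space R).

Definition rad2 p : R := p.1.1 ^+ 2 + p.1.2 ^+ 2.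

Definition rot a p : Defs.space R :=
  ((p.1.1 * cos (2 * pi * a) - p.1.2 * sin (2 * pi * a),
    p.1.1 * sin (2 * pi * a) + p.1.2 * cos (2 * pi * a)), p.2).

(** The rotation by [a] turns of the vertical cylinder of radius 1 around the
origin, which is the boundary of the hole of index 0, and the identity
elsewhere. *)
Definition spin a p : Defs.space R := if rad2 p == 1 then rot a p else p.

Lemma space_eq p q : p.1.1 = q.1.1 -> p.1.2 = q.1.2 -> p.2 = q.2 -> p = q.
Proof. by case: p => [[? ?] ?]; case: q => [[? ?] ?] /= -> -> ->. Qed.

Lemma rad2_rot a p : rad2 (rot a p) = rad2 p.
Proof.
have := cos2Dsin2 (2 * pi * a); rewrite /rad2 /rot /=.
move: (cos _) (sin _) => c s cs.
by rewrite -[RHS]mulr1 -cs; ring.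
Qed.

Lemma rad2_spin a p : rad2 (spin a p) = rad2 p.
Proof. by rewrite /spin; case: ifP => // _; rewrite rad2_rot. Qed.

Lemma spin_height a p : (spin a p).2 = p.2.
Proof. by rewrite /spin; case: ifP. Qed.

Lemma spinD a b p : spin a (spin b p) = spin (a + b) p.
Proof.
rewrite {1}/spin rad2_spin /spin; case: ifP => [p1|-> //]; rewrite p1.
rewrite /rot (mulrDr (2 * pi) a b) cosD sinD; apply: space_eq => //=.
- by move: (cos _) (sin _) (cos _) (sin _) => *; ring.
- by move: (cos _) (sin _) (cos _) (sin _) => *; ring.
Qed.

Lemma rot_int a p : a \is a Num.int -> rot a p = p.
Proof.
move=> /(cos_sin_turn_int 0); rewrite add0r mulr0 cos0 sin0 => -[ca sa].
by apply: space_eq; rewrite //= ca sa !mulr0 !mulr1 ?subr0 ?add0r.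
Qed.

Lemma spin_int a p : a \is a Num.int -> spin a p = p.
Proof. by move=> ia; rewrite /spin rot_int// if_same. Qed.

Variable Z : topologicalType.

Lemma continuous_rad2 : continuous rad2.
Proof.
move=> p; have c1 : {for p, continuous (fun p : Defs.space R => p.1.1)}.
  by apply: (@continuous_comp _ _ _ fst fst); exact: cvg_fst.
have c2 : {for p, continuous (fun p : Defs.space R => p.1.2)}.
  by apply: (@continuous_comp _ _ _ fst snd); [exact: cvg_fst|exact: cvg_snd].
by apply: cvgD; apply: cvgM.
Qed.

Lemma continuous_rot (b : Z -> R) (p : Z -> Defs.space R) z :
  {for z, continuous b} -> {for z, continuous p} ->
  {for z, continuous (fun z => rot (b z) (p z))}.
Proof.
move=> cb cp.
have cx : {for z, continuous (fun z => (p z).1.1)}.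
  apply: (@continuous_comp _ _ _ p (fun p : Defs.space R => p.1.1)); first exact: cp.
  by apply: (@continuous_comp _ _ _ fst fst); exact: cvg_fst.
have cy : {for z, continuous (fun z => (p z).1.2)}.
  apply: (@continuous_comp _ _ _ p (fun p : Defs.space R => p.1.2)); first exact: cp.
  by apply: (@continuous_comp _ _ _ fst snd); [exact: cvg_fst|exact: cvg_snd].
have cz : {for z, continuous (fun z => (p z).2)}.
  by apply: (@continuous_comp _ _ _ p snd); [exact: cp|exact: cvg_snd].
have c2b : {for z, continuous (fun z => 2 * pi * b z)}.
  by apply: cvgM => //; exact: cvg_cst.
have cc : {for z, continuous (fun z => cos (2 * pi * b z))}.
  apply: (@continuous_comp _ _ _ (fun z => 2 * pi * b z) (@cos R)) => //.
  exact: continuous_cos.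
have cs : {for z, continuous (fun z => sin (2 * pi * b z))}.
  apply: (@continuous_comp _ _ _ (fun z => 2 * pi * b z) (@sin R)) => //.
  exact: continuous_sin.
apply: continuous_pair => //; apply: continuous_pair.
- by apply: cvgB; apply: cvgM.
- by apply: cvgD; apply: cvgM.
Qed.

End Spin.

Lemma nbhs_space_box (R : realType) (p : Defs.space R) (P : Defs.space R -> Prop) :
  nbhs p P -> exists2 d : R, 0 < d & forall q,
    `|q.1.1 - p.1.1| < d -> `|q.1.2 - p.1.2| < d -> `|q.2 - p.2| < d -> P q.
Proof.
move=> H; have [e e0 he] := (@nbhs_ballP R (R * R * R)%type p P).1 H.
exists e => // v h1 h2 h3.
by apply: he; split => /=; [split|]; rewrite /= -ball_normE /= distrC.
Qed.

Section BoundarySurface.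
Variables (R : realType) (g : nat).
Hypothesis g_gt0 : (0 < g)%N.
Implicit Types (p q : Defs.space R).

Let S : set (Defs.space R) := handlebody_boundary g.

Let big_ge4 : 4 <= (3 * g + 1)%N%:R :> R.
Proof. by rewrite (ler_nat R 4); lia. Qed.

(** The holes other than the one of index 0 have centres at distance at least 3
from the origin, so they avoid the disc of radius 2. *)
Lemma annulus_handlebody p : 1 <= rad2 p <= 4 -> 0 <= p.2 <= 1 -> handlebody g p.
Proof.
rewrite /rad2 => p1 p2; split => //.
  have := big_ge4; move: (3 * g + 1)%N%:R => L L4; nra.
move=> i; have [i0|i0] := posnP i.
  by rewrite i0 muln0 subr0; lra.
have : 3 <= (3 * i)%N%:R :> R by rewrite (ler_nat R 3); lia.
move: (3 * i)%N%:R => c c3; have x2 : p.1.1 <= 2 by nra.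
nra.
Qed.

Lemma handlebody_rad2_ge1 p : handlebody g p -> 1 <= rad2 p.
Proof. by case=> _ /(_ (Ordinal g_gt0)); rewrite muln0 subr0. Qed.

Lemma boundary_closed_property (P : set (Defs.space R)) : closed P ->
  handlebody g `<=` P -> S `<=` P.
Proof. by move=> cP HP p [/(closure_subset HP)]; rewrite -(closure_id _).1. Qed.

Lemma boundary_height p : S p -> 0 <= p.2 <= 1.
Proof.
have cz : continuous (fun p : Defs.space R => p.2) by move=> ?; exact: cvg_snd.
apply: (@boundary_closed_property (fun p => 0 <= p.2 <= 1)); last by move=> q [].
have -> : (fun p => 0 <= p.2 <= 1 : Prop) =
    (fun p : Defs.space R => p.2) @^-1` `[0, 1]%classic.
  by apply/funext => q; rewrite /= in_itv.
by apply: closed_comp; [move=> *; exact: cz|exact: itv_closed].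
Qed.

Lemma boundary_rad2_ge1 p : S p -> 1 <= rad2 p.
Proof.
apply: (@boundary_closed_property (fun p => 1 <= rad2 p)); last exact: handlebody_rad2_ge1.
apply: (@closed_comp _ _ (@rad2 R) [set x | 1 <= x]); last exact: closed_ge.
by move=> *; exact: continuous_rad2.
Qed.

(** Near the inner cylinder and away from the top and the bottom, the surface
consists of the cylinder only: other points of the shell of radius between 1
and 2 are interior to the handlebody. *)
Lemma boundary_near_annulus p :
  S p -> rad2 p < 4 -> 0 < p.2 < 1 -> rad2 p = 1.
Proof.
move=> Sp p4 /andP[z0 z1]; have := boundary_rad2_ge1 Sp.
rewrite le_eqVlt => /predU1P[//|p1]; case: Sp => _ []; rewrite /interior.
have cz : {for p, continuous (fun p : Defs.space R => p.2)} by exact: cvg_snd.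
near=> q; apply: annulus_handlebody.
- apply/andP; split; apply: ltW; near: q.
  + by apply: (cvgr_gt _ (@continuous_rad2 R p)).
  + by apply: (cvgr_lt _ (@continuous_rad2 R p)).
- apply/andP; split; apply: ltW; near: q.
  + by apply: (cvgr_gt _ cz).
  + by apply: (cvgr_lt _ cz).
Unshelve. all: by end_near. Qed.

(** A point of the handlebody where one of its defining inequalities is an
equality leaves it under an arbitrarily small vertical translation or
horizontal homothety. *)
Lemma handlebody_boundaryP p : handlebody g p ->
  [\/ p.2 = 0, p.2 = 1, rad2 p = 1 | rad2 p = (3 * g + 1)%N%:R ^+ 2] -> S p.
Proof.
move=> Hp E; split; first exact: subset_closure.
move=> /nbhs_space_box[d d0 hd].
(* The coordinates are bounded by the radius [3 g + 1] of the handlebody, so a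
   homothety of ratio [1 + e] or [1 - e] moves them by less than [d]. *)
pose e := Num.min (d / (3 * g + 1)%N%:R / 2) 2^-1.
have L4 := big_ge4.
have e0 : 0 < e by rewrite lt_min !divr_gt0//; lra.
have e2 : e <= 2^-1 by rewrite ge_min lexx orbT.
have ed : e * (3 * g + 1)%N%:R < d.
  apply: (@le_lt_trans _ _ (d / 2)); last lra.
  rewrite -ler_pdivlMr; last lra.
  by rewrite /e ge_min (_ : d / 2 / _ = d / (3 * g + 1)%N%:R / 2) ?lexx// mulrAC.
have [Hp1 _ _] := Hp; have := handlebody_rad2_ge1 Hp; move: Hp1; rewrite -/(rad2 p).
move: ed L4 E; move Lg : (3 * g + 1)%N%:R => L ed L4 E pL p1.
have eL : e < d by nra.
have L0 : 0 <= L by lra.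
have xL : `|p.1.1| <= L.
  rewrite -(ger0_norm L0) -!sqrtr_sqr ler_wsqrtr// (le_trans _ pL)//.
  by rewrite lerDl sqr_ge0.
have yL : `|p.1.2| <= L.
  rewrite -(ger0_norm L0) -!sqrtr_sqr ler_wsqrtr// (le_trans _ pL)//.
  by rewrite lerDr sqr_ge0.
have scale c x : `|c| = e -> `|x| <= L -> `|(1 + c) * x - x| < d.
  move=> ce xx; rewrite (_ : _ - _ = c * x); last by ring.
  by rewrite normrM ce; apply: le_lt_trans ed; rewrite ler_pM2l.
have d00 x : `|x - x| < d by rewrite subrr normr0.
have scaleH c : `|c| = e -> handlebody g (((1 + c) * p.1.1, (1 + c) * p.1.2), p.2).
  by move=> ce; apply: hd => //=; exact: scale.
have rad2_scale c :
    rad2 (((1 + c) * p.1.1, (1 + c) * p.1.2), p.2) = (1 + c) ^+ 2 * rad2 p.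
  by rewrite /rad2 /=; ring.
case: E => E.
- have [_ _ /=] : handlebody g (p.1, p.2 - e).
    by apply: hd => //=; rewrite addrAC subrr add0r normrN gtr0_norm.
  by rewrite E; lra.
- have [_ _ /=] : handlebody g (p.1, p.2 + e).
    by apply: hd => //=; rewrite addrAC subrr add0r gtr0_norm.
  by rewrite E; lra.
- have := handlebody_rad2_ge1 (scaleH (- e) _); rewrite normrN gtr0_norm// => /(_ erefl).
  rewrite rad2_scale E; nra.
- have [] := scaleH e (gtr0_norm e0); rewrite -/(rad2 _) rad2_scale E Lg => h _ _.
  have M0 : 0 < L ^+ 2 by rewrite exprn_gt0//; lra.
  have := mulr_gt0 e0 M0; have := mulr_gt0 e0 (mulr_gt0 e0 M0).
  by move: (L ^+ 2) h => M; rewrite sqrrD; lra.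
Qed.

Lemma spin_boundary a p : S p -> S (spin a p).
Proof.
move=> Sp; rewrite /spin; case: eqP => [p1|_]; last by [].
apply: handlebody_boundaryP.
  apply: annulus_handlebody; first by rewrite rad2_rot p1; lra.
  exact: (boundary_height Sp).
by constructor 3; rewrite rad2_rot.
Qed.

End BoundarySurface.

(** * The Dehn twist *)

Section Twist.
Variables (R : realType) (g : nat).
Hypothesis g_gt0 : (0 < g)%N.

Let S : topologicalType := boundary_surface R g.
Implicit Types (x y : S) (a b : R) (k l : int).

Lemma surface_boundary x : handlebody_boundary g (set_val x).
Proof. exact: set_valP. Qed.

Definition spin_surface a x : S :=
  exist _ (spin a (set_val x))
    (mem_set (spin_boundary g_gt0 a (surface_boundary x))).

Definition height x : R := (set_val x).2.

Definition twist k x : S := spin_surface (k%:~R * height x) x.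

Lemma set_val_spin a x : set_val (spin_surface a x) = spin a (set_val x).
Proof. by []. Qed.

Lemma surface_eq x y : set_val x = set_val y -> x = y.
Proof. exact: val_inj. Qed.

Lemma spin_surfaceD a b x :
  spin_surface a (spin_surface b x) = spin_surface (a + b) x.
Proof. by apply: surface_eq; exact: spinD. Qed.

Lemma spin_surface_int a x : a \is a Num.int -> spin_surface a x = x.
Proof. by move=> ia; apply: surface_eq; exact: spin_int. Qed.

Lemma height_spin a x : height (spin_surface a x) = height x.
Proof. exact: spin_height. Qed.

Lemma height_itv x : 0 <= height x <= 1.
Proof. exact: (boundary_height (surface_boundary x)). Qed.

Lemma continuous_height : continuous height.
Proof.
move=> x; apply: (@continuous_comp _ _ _ (set_val : S -> Defs.space R) snd).
  exact: continuous_set_val.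
exact: cvg_snd.
Qed.

Section SpinContinuous.
Variables (Z : topologicalType) (b : Z -> R) (x : Z -> S) (z : Z).
Hypotheses (cb : {for z, continuous b}) (cx : {for z, continuous x}).

Let cp : {for z, continuous (fun z => set_val (x z))}.
Proof.
apply: (@continuous_comp _ _ _ x set_val); first exact: cx.
exact: continuous_set_val.
Qed.

Let crad : {for z, continuous (fun z => rad2 (set_val (x z)))}.
Proof.
apply: (@continuous_comp _ _ _ (fun z => set_val (x z)) (@rad2 R)).
  exact: cp.
exact: continuous_rad2.
Qed.

Let ch : {for z, continuous (fun z => height (x z))}.
Proof.
by apply: (@continuous_comp _ _ _ x height); [exact: cx|exact: continuous_height].
Qed.

Let near_off_annulus : rad2 (set_val (x z)) <> 1 ->
  \forall z' \near z, (rad2 (set_val (x z')) == 1) = false.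
Proof.
move=> /eqP; rewrite neq_lt ltNge (boundary_rad2_ge1 g_gt0 (surface_boundary _)) /=.
move=> p1; near=> z'; rewrite gt_eqF//; near: z'.
by apply: (cvgr_gt _ crad).
Unshelve. all: by end_near. Qed.

(** A value of [spin_surface] is either the rotated point or the original one,
so it lies in [V] as soon as both do. *)
Lemma near_spin_surface (V : set (Defs.space R)) :
  (rad2 (set_val (x z)) = 1 -> nbhs (rot (b z) (set_val (x z))) V) ->
  nbhs (set_val (x z)) V ->
  \forall z' \near z, V (set_val (spin_surface (b z') (x z'))).
Proof.
move=> V1 V2; have cr := continuous_rot cb cp.
have [p1|p1] := pselect (rad2 (set_val (x z)) = 1).
- near=> z'; rewrite set_val_spin /spin; case: ifP => _; near: z'.
  + exact: (cr _ (V1 p1)).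
  + exact: cp.
- near=> z'; rewrite set_val_spin /spin ifF; first by near: z'; exact: cp.
  by near: z'; exact: near_off_annulus.
Unshelve. all: by end_near. Qed.

(** The rotated cylinder and the rest of the surface meet along the two circles
at heights 0 and 1; the rotation is continuous if it is trivial there. *)
Lemma continuous_spin_surface :
  (rad2 (set_val (x z)) = 1 -> height (x z) = 0 \/ height (x z) = 1 ->
    b z \is a Num.int) ->
  {for z, continuous (fun z => spin_surface (b z) (x z))}.
Proof.
move=> ib; apply: continuous_into_set_type => V.
rewrite set_val_spin /spin; case: eqP => p1 Vz.
- have cr := continuous_rot cb cp.
  have [ih|nh] := pselect (height (x z) = 0 \/ height (x z) = 1).
    by apply: near_spin_surface => //; rewrite -(rot_int (set_val (x z)) (ib p1 ih)).
  have h01 : 0 < height (x z) < 1.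
    have /andP[h0 h1] := height_itv (x z).
    by rewrite !lt_neqAle h0 h1 !andbT; apply/andP; split; apply/eqP => h;
      apply: nh; [left|right].
  have /andP[h0 h1] := h01.
  have p4 : rad2 (set_val (x z)) < 4 by rewrite p1; lra.
  suff : \forall z' \near z, V (spin (b z') (set_val (x z'))) by [].
  near=> z'; rewrite /spin ifT; first by near: z'; exact: cr.
  apply/eqP; apply: (@boundary_near_annulus _ _ g_gt0).
  + exact: surface_boundary.
  + by near: z'; apply: (cvgr_lt _ crad).
  + apply/andP; split; near: z'.
    * by apply: (cvgr_gt _ ch).
    * by apply: (cvgr_lt _ ch).
- exact: near_spin_surface.
Unshelve. all: by end_near. Qed.

End SpinContinuous.

Lemma twistD k l x : twist k (twist l x) = twist (k + l) x.
Proof. by rewrite /twist height_spin spin_surfaceD -mulrDl -intrD. Qed.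

Lemma twist0 x : twist 0 x = x.
Proof. by rewrite /twist mul0r spin_surface_int// rpred0. Qed.

Lemma twistK k : cancel (twist k) (twist (- k)).
Proof. by move=> x; rewrite twistD addNr twist0. Qed.

Lemma twistNK k : cancel (twist (- k)) (twist k).
Proof. by move=> x; rewrite twistD subrr twist0. Qed.

Lemma continuous_twist k : continuous (twist k).
Proof.
move=> x; apply: (@continuous_spin_surface _ (fun x => k%:~R * height x) id).
- apply: (@cvgM R S (nbhs x) _ (cst k%:~R) height); first exact: cvg_cst.
  exact: continuous_height.
- exact: cvg_id.
- by move=> _ [] ->; rewrite ?mulr0 ?mulr1 ?rpred0 ?intr_int.
Qed.

Lemma twist_homeo k : is_homeo (twist k).
Proof.
by exists (twist (- k)); split;
  [exact: twistK|exact: twistNK|exact: continuous_twist|exact: continuous_twist].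
Qed.

Variable o : orientation R S.

Lemma twist_chart k (phi : plane R -> S) : is_chart phi -> is_chart (twist k \o phi).
Proof.
move=> [cphi iphi ophi]; split.
- by move=> p; apply: continuous_comp; [exact: cphi|exact: continuous_twist].
- exact: inj_comp (can_inj (twistK k)) iphi.
- move=> U oU; rewrite (_ : _ @` U = twist (- k) @^-1` (phi @` U)).
    apply: open_comp; first by move=> x _; exact: continuous_twist.
    exact: ophi.
  apply/seteqP; split => [_ [p Up <-] /=|x /= [p Up px]].
    by rewrite twistK; exists p.
  by exists p => //=; rewrite px twistNK.
Qed.

(** The twist is isotopic to the identity away from the top of the cylinder, by
the rotations of angle [s k z] at height [z], and also away from the bottom,
by the rotations of angle [s k (z - 1)], because a rotation by [k] turns is
trivial.  Every point has a neighbourhood in which one of the two isotopies is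
continuous. *)
Lemma twist_oriented_sub k (phi : plane R -> S) :
  oriented_charts o phi -> oriented_charts o (twist k \o phi).
Proof.
move=> ophi; have cphi := oriented_chartP ophi.
have [ccphi iphi _] := cphi.
apply: oriented_maximal; first exact: twist_chart.
move=> psi opsi p q pq.
(* [e] is the height at which the isotopy fixes the cylinder, and [U] avoids
   the other end. *)
pose e : int := if height (phi p) == 1 then 1%Z else 0%Z.
pose U v := if height (phi p) == 1 then 0 < height (phi v) else height (phi v) < 1.
have chphi v : {for v, continuous (fun v => height (phi v))}.
  by apply: (@continuous_comp _ _ _ phi height); [exact: ccphi|exact: continuous_height].
have nU : nbhs p U.
  rewrite /U; case: eqP => h; near=> v.
    by near: v; apply: (cvgr_gt _ (chphi p)); rewrite h.
  near: v; apply: (cvgr_lt _ (chphi p)).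
  by have /andP[_] := height_itv (phi p); rewrite le_eqVlt => /predU1P[].
pose f (y : R * plane R) :=
  spin_surface (y.1 * (k%:~R * (height (phi y.2) - e%:~R))) (phi y.2).
have cf s v : U v -> {for (s, v), continuous f}.
  move=> Uv; apply: (@continuous_spin_surface _
    (fun y : R * plane R => y.1 * (k%:~R * (height (phi y.2) - e%:~R)))
    (fun y : R * plane R => phi y.2)).
  - apply: cvgM; first exact: cvg_fst.
    apply: cvgM; first exact: cvg_cst.
    apply: cvgB; last exact: cvg_cst.
    apply: (@continuous_comp _ _ _ snd (fun v => height (phi v))).
      exact: cvg_snd.
    exact: chphi.
  - by apply: (@continuous_comp _ _ _ snd phi); [exact: cvg_snd|exact: ccphi].
  - move: Uv; rewrite /U /e /=; case: eqP => _ Uv _ [] hv; rewrite hv in Uv *.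
    + by rewrite ltxx in Uv.
    + by rewrite subrr !mulr0 rpred0.
    + by rewrite subrr !mulr0 rpred0.
    + by rewrite ltxx in Uv.
have inj_f s v : U v -> f (s, v) = f (s, p) -> v = p.
  move=> _ fE; apply: iphi.
  have hE : height (phi v) = height (phi p).
    by have := congr1 height fE; rewrite /f /= !height_spin.
  move: fE; rewrite /f /= hE; set a := s * _ => /(congr1 (spin_surface (- a))).
  by rewrite !spin_surfaceD addNr !spin_surface_int ?rpred0.
have f0 v : f (0, v) = phi v by rewrite /f /= mul0r spin_surface_int// rpred0.
have f1 v : f (1, v) = twist k (phi v).
  rewrite /f /twist /= mul1r mulrBr.
  rewrite -[X in _ = X](@spin_surface_int (- (k%:~R * e%:~R))).
    by rewrite spin_surfaceD addrC.
  by rewrite rpredN rpredM// intr_int.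
have pos0 chi q' : oriented_charts o chi -> f (0, p) = chi q' ->
    \forall r \near 0^'+, positive_circle (fun v => f (0, v)) p chi q' r.
  move=> ochi; rewrite f0 => pq'.
  have -> : (fun v => f (0, v)) = phi by apply/funext.
  exact: (oriented_transition ophi ochi pq').
have := isotopy_positive nU cf inj_f pos0 opsi.
move=> /(_ 1 q); rewrite f1 => /(_ pq).
have -> : (fun v => f (1, v)) = twist k \o phi by apply/funext.
by [].
Unshelve. all: by end_near. Qed.

Lemma twist_oriented k (phi : plane R -> S) :
  oriented_charts o (twist k \o phi) <-> oriented_charts o phi.
Proof.
split=> [/(@twist_oriented_sub (- k))|]; last exact: twist_oriented_sub.
rewrite compA (_ : twist (- k) \o twist k = id)//.
by apply/funext => x /=; rewrite twistK.
Qed.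

Definition twist_ohomeo k : ohomeo o :=
  OHomeo (twist_homeo k) (@twist_oriented k).

End Twist.

(** * The invariant of double cosets *)

Section CircleHomotopy.
Variables (R : realType) (X : topologicalType).
Implicit Types (u v w : X -> R).

Definition circle_homotopic u v : Prop := exists K : R * X -> R,
  [/\ circle_continuous K, forall x, K (0, x) = u x & forall x, K (1, x) = v x].

Lemma circle_homotopic_refl u : circle_continuous u -> circle_homotopic u u.
Proof.
move=> cu; exists (fun y => u y.2); split => // y.
by apply: (@circle_cvg_comp R _ _ u snd); [exact: cvg_snd|exact: cu].
Qed.

Lemma circle_homotopic_end u v : circle_homotopic u v -> circle_continuous v.
Proof.
move=> [K [cK _ K1]] x.
apply: (@circle_cvg_int _ _ (fun x => K (1, x))).
  by move=> y; rewrite K1 subrr rpred0.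
apply: (@circle_cvg_comp R _ _ K (fun x => (1, x))) => //.
by apply: continuous_pair; [exact: cvg_cst|exact: cvg_id].
Qed.

Lemma circle_homotopicD u v u' v' :
  circle_homotopic u v -> circle_homotopic u' v' ->
  circle_homotopic (u \+ u') (v \+ v').
Proof.
move=> [K [cK K0 K1]] [K' [cK' K0' K1']]; exists (K \+ K'); split.
- by move=> y; exact: circle_cvgD.
- by move=> x; rewrite /= K0 K0'.
- by move=> x; rewrite /= K1 K1'.
Qed.

(** The group structure of the circle makes the concatenation of homotopies
unnecessary: the sum of a homotopy from [u] to [v] and of one from [v] to [w],
minus [v], is a homotopy from [u] to [w]. *)
Lemma circle_homotopic_trans v u w :
  circle_homotopic u v -> circle_homotopic v w -> circle_homotopic u w.
Proof.
move=> uv vw; have cv := circle_homotopic_end uv.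
have := circle_homotopicD (circle_homotopicD uv vw)
  (circle_homotopic_refl (fun x => circle_cvgN (cv x))).
have -> : (u \+ v) \+ (\- v) = u by apply/funext => x /=; rewrite addrK.
suff -> : (v \+ w) \+ (\- v) = w by [].
by apply/funext => x /=; rewrite addrAC subrr add0r.
Qed.

End CircleHomotopy.

Lemma circle_homotopic_comp (R : realType) (X Y : topologicalType)
    (u v : Y -> R) (f : X -> Y) :
  continuous f -> circle_homotopic u v -> circle_homotopic (u \o f) (v \o f).
Proof.
move=> cf [K [cK K0 K1]]; exists (fun y => K (y.1, f y.2)); split => //.
move=> y; apply: (@circle_cvg_comp R _ _ K (fun y => (y.1, f y.2))) => //.
apply: continuous_pair; first exact: cvg_fst.
by apply: (@continuous_comp _ _ _ snd f); [exact: cvg_snd|exact: cf].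
Qed.

Lemma isotopic_circle_homotopic (R : realType) (S : topologicalType)
    (f g : S -> S) (u : S -> R) :
  isotopic R f g -> circle_continuous u -> circle_homotopic (u \o f) (u \o g).
Proof.
move=> [F [cF _ F0 F1]] cu.
exists (fun y => u (F (clamp y.1, y.2))); split.
- move=> y; apply: (@circle_cvg_comp R _ _ u (fun y => F (clamp y.1, y.2))) => //.
  pose c (y : R * S) := (clamp y.1, y.2).
  have cc : {for y, continuous c}.
    apply: continuous_pair; last exact: cvg_snd.
    apply: (@continuous_comp _ _ _ fst (@clamp R)); first exact: cvg_fst.
    exact: continuous_clamp.
  have Ac z : (`[0, 1]%classic `*` setT) (c z).
    by split => //=; rewrite in_itv /= clamp_itv.
  move/subspace_continuousP : cF => /(_ (c y) (Ac y)) cF.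
  apply: (@cvg_comp _ _ _ c F _ _ _ _ cF) => V /cc; rewrite /= => H.
  by apply: (@filterS _ (nbhs y) _ _ _ _ H) => z /=; apply; exact: Ac.
- by move=> x; rewrite /= clamp0 F0.
- by move=> x; rewrite /= clamp1 F1.
Qed.

Section SplittingInvariant.
Variables (R : realType) (g : nat).
Let S : topologicalType := boundary_surface R g.
Let H : topologicalType := handlebody_space R g.
Variable o : orientation R S.
Implicit Types (u v w : S -> R) (f h : S -> S) (d : nat).

(** The maps from the surface to the circle that extend over the handlebody;
their homotopy classes form the subgroup called L in the introduction. *)
Definition extends_to_circle u : Prop := circle_continuous u /\
  exists2 U : H -> R, circle_continuous U &
    forall (x : S) (y : H), set_val y = set_val x -> U y = u x.

(** In terms of classes in H^1(S), the image of L under [f] is contained in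
L + d H^1(S), with L as in the introduction. *)
Definition trivial_mod d (f : S -> S) : Prop :=
  forall u, extends_to_circle u -> exists v w,
    [/\ extends_to_circle v, circle_continuous w &
        circle_homotopic (u \o f) (fun x => v x + w x *+ d)].

Lemma extends_to_circle_comp f u : continuous f -> extends_over_handlebody f ->
  extends_to_circle u -> extends_to_circle (u \o f).
Proof.
move=> cf [F [[F' [_ _ cF _]] Ff]] [cu [U cU Uu]]; split.
  by move=> x; apply: circle_cvg_comp; [exact: cf|exact: cu].
exists (U \o F).
  by move=> y; apply: circle_cvg_comp; [exact: cF|exact: cU].
by move=> x y yx /=; apply: Uu; exact: Ff.
Qed.

Lemma continuous_ohomeo (f : ohomeo o) : continuous f.
Proof. by have [h [_ _ cf _]] := ohomeo_homeo f. Qed.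

Lemma trivial_mod_isotopic d f h : isotopic R h f ->
  trivial_mod d f -> trivial_mod d h.
Proof.
move=> hf tf u eu; have [v [w [ev cw fvw]]] := tf u eu.
exists v, w; split => //; apply: circle_homotopic_trans fvw.
by apply: isotopic_circle_homotopic hf _; have [] := eu.
Qed.

Lemma trivial_mod_comp d f (a b : ohomeo o) :
  extends_over_handlebody a -> extends_over_handlebody b ->
  trivial_mod d f -> trivial_mod d (a \o f \o b).
Proof.
move=> ea eb tf u eu.
have [v [w [ev cw fvw]]] := tf _ (extends_to_circle_comp (@continuous_ohomeo a) ea eu).
have cb := @continuous_ohomeo b.
exists (v \o b), (w \o b); split.
- exact: extends_to_circle_comp.
- by move=> x; apply: circle_cvg_comp; [exact: cb|exact: cw].
- exact: (circle_homotopic_comp cb fvw).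
Qed.

Local Open Scope quotient_scope.

Definition mcg_trivial_mod d (phi : mcg o) : Prop := trivial_mod d (repr phi).

Lemma mcg_trivial_modE d (f : ohomeo o) :
  mcg_trivial_mod d (\pi_(mcg o) f) <-> trivial_mod d f.
Proof.
have /asboolP i1 := isotopicb_repr f.
split; last exact: trivial_mod_isotopic.
exact/trivial_mod_isotopic/isotopic_sym.
Qed.

(** The set of the [d] modulo which a mapping class is trivial is an invariant
of the Heegaard splitting. *)
Lemma heegaard_trivial_mod d (phi psi : mcg o) :
  heegaard_equiv phi psi -> mcg_trivial_mod d psi -> mcg_trivial_mod d phi.
Proof.
move=> E; have : double_coset (@handlebody_group R g o) phi phi.
  have K1 : handlebody_group (1%g : mcg o).
    exists 1%g => //; exists id; split; first exact: is_homeo_id.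
    by [].
  by exists 1%g => //; exists 1%g => //; rewrite mul1g mulg1.
rewrite E => -[_ [a ea <-] [_ [b eb <-] <-]] tpsi.
rewrite -[psi]reprK.
have -> : (\pi_(mcg o) a * \pi_(mcg o) (repr psi) * \pi_(mcg o) b)%g =
    \pi_(mcg o) (a * repr psi * b)%g by rewrite -!mcg_mulE.
apply/mcg_trivial_modE.
exact: trivial_mod_comp.
Qed.

End SplittingInvariant.

(** * The invariant of the powers of the twist *)

Section TwistTrivial.
Variables (R : realType) (g : nat).
Hypothesis g_gt0 : (0 < g)%N.
Let S : topologicalType := boundary_surface R g.
Local Notation twist := (@twist R g g_gt0).
Local Notation spin_surface := (@spin_surface R g g_gt0).

(** Although the rotations by [s k z] turns with fractional [s] tear the surface
along the top circle, they act on the functions that vanish there: this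
deforms [u \o twist k] to [u]. *)
Lemma circle_continuous_slide (k : int) (u : S -> R) : circle_continuous u ->
  (forall x, height x = 1 -> u x = 0) ->
  circle_continuous
    (fun y : R * S => u (spin_surface ((1 - y.1) * (k%:~R * height y.2)) y.2)).
Proof.
move=> cu u0 [s x].
pose b (y : R * S) := (1 - y.1) * (k%:~R * height y.2).
have cb : {for (s, x), continuous b}.
  apply: cvgM; first by apply: cvgB; [exact: cvg_cst|exact: cvg_fst].
  apply: cvgM; first exact: cvg_cst.
  apply: (@continuous_comp _ _ _ snd (@height R g)); first exact: cvg_snd.
  exact: continuous_height.
have [[p1 h1]|nh] := pselect (rad2 (set_val x) = 1 /\ height x = 1); last first.
  apply: (@circle_cvg_comp R _ _ u (fun y => spin_surface (b y) y.2)); last exact: cu.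
  apply: continuous_spin_surface => //; first exact: cvg_snd.
  move=> /= p1 [h0|h1]; last by case: nh.
  by rewrite /b /= h0 !mulr0 rpred0.
move=> e e0.
have near_u (y : S) : height y = 1 -> exists V : set (Defs.space R),
    nbhs (set_val y) V /\ forall z, V (set_val z) -> `|cres (u z)| < e.
  move=> hy; have := cu y e e0; rewrite nbhsE => -[W [[V oV <-] Vy] WV].
  exists V; split; first by exists V.
  by move=> z Vz; have := WV z Vz; rewrite /= (u0 y hy) subr0.
have [V1 [nV1 uV1]] :=
  near_u (spin_surface (b (s, x)) x) (etrans (height_spin _ _ _) h1).
have [V2 [nV2 uV2]] := near_u x h1.
have : \forall y \near (s, x), (V1 `|` V2) (set_val (spin_surface (b y) y.2)).
  apply: near_spin_surface => //; first exact: cvg_snd.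
  - move=> _ /=.
    have <- : set_val (spin_surface (b (s, x)) x) = rot (b (s, x)) (set_val x).
      by rewrite set_val_spin /spin p1 eqxx.
    by apply: filterS nV1; exact: subsetUl.
  - by apply: filterS nV2; exact: subsetUr.
have z0 : u (spin_surface (b (s, x)) x) = 0 by apply: u0; rewrite height_spin.
apply: filterS => y Vy.
change (`|cres (u (spin_surface (b y) y.2) - u (spin_surface (b (s, x)) x))| < e).
by rewrite z0 subr0; case: Vy => [/uV1|/uV2].
Qed.

(** The difference [w] between [u \o twist 1] and [u] vanishes at the top of the
cylinder, so its composites with the powers of the twist are homotopic to
[w].  Summing over the powers shows that [u \o twist k] is homotopic to
[u + k w]. *)
Lemma twist_trivial_mod k : trivial_mod k (twist k%:Z).
Proof.
move=> u eu; have [cu _] := eu.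
pose w (x : S) := u (twist 1 x) - u x.
have cw : circle_continuous w.
  move=> x; apply: circle_cvgD; last exact: circle_cvgN.
  by apply: (@circle_cvg_comp R _ _ u (twist 1)); [exact: continuous_twist|exact: cu].
exists u, w; split => //.
elim: k => [|k IH].
  rewrite (_ : u \o _ = u); last by apply/funext => x /=; rewrite twist0.
  rewrite (_ : (fun x => _) = u); first exact: circle_homotopic_refl.
  by apply/funext => x; rewrite mulr0n addr0.
have slide : circle_homotopic (w \o twist k) w.
  exists (fun y => w (spin_surface ((1 - y.1) * (k%:~R * height y.2)) y.2)); split.
  - apply: circle_continuous_slide => // x h1.
    by rewrite /w /twist h1 mulr1 spin_surface_int ?subrr// intr_int.
  - by move=> x; rewrite /= subr0 mul1r.
  - by move=> x; rewrite /= subrr mul0r spin_surface_int ?rpred0.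
have := circle_homotopicD IH slide.
rewrite (_ : _ \+ _ = u \o twist k.+1); last first.
  apply/funext => x /=; rewrite /w twistD addrC subrK.
  by congr (u (twist _ x)); lia.
rewrite (_ : _ \+ _ = (fun x => u x + w x *+ k.+1)) //.
by apply/funext => x /=; rewrite -addrA -mulrSr.
Qed.

End TwistTrivial.

Section Meridian.
Variables (R : realType) (g : nat).
Hypothesis g_gt0 : (0 < g)%N.
Let S : topologicalType := boundary_surface R g.
Let H : topologicalType := handlebody_space R g.
Local Notation twist := (@twist R g g_gt0).
Let L : R := (3 * g + 1)%N%:R.
Implicit Types (a b t : R).

Let L4 : 4 <= L.
Proof. by rewrite /L (ler_nat R 4); lia. Qed.

(** The rectangle in the half-plane [y = 0], [x < 0] that joins the inner to the
outer cylinder; all holes have their centres at [x >= 0], so they avoid it. *)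
Definition meridian_disc a b : Defs.space R := ((-1 - (L - 1) * a, 0), b).

Lemma meridian_disc_handlebody a b :
  0 <= a <= 1 -> 0 <= b <= 1 -> handlebody g (meridian_disc a b).
Proof.
move=> a01 b01; have x1 : 1 <= 1 + (L - 1) * a <= L.
  by have := L4; move: L => l l4; apply/andP; split; nra.
rewrite /meridian_disc; split => //=; rewrite -/L.
  move: (L) L4 x1 => l l4; set c := (l - 1) * a => ?; nra.
move=> i; have : 0 <= (3 * i)%N%:R :> R by [].
move: (3 * i)%N%:R x1 => n; set c := (L - 1) * a => ? ?; nra.
Qed.

(** The meridian runs around the rectangle in four equal times: up the inner
cylinder, outwards along the top, down the outer cylinder, back along the
bottom.  [loop_out] and [loop_up] are the two coordinates. *)
Definition loop_out t : R := clamp (4 * t - 1) - clamp (4 * t - 3).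
Definition loop_up t : R := clamp (4 * t) - clamp (4 * t - 2).

Let clamp_diff a b : b + 1 <= a -> 0 <= clamp a - clamp b <= 1.
Proof.
move=> ba; have := clamp_itv a; have := clamp_itv b.
have [b0|b0] := lerP b 0; first by rewrite (clamp_le0 b0); lra.
by rewrite (@clamp_ge1 R a); lra.
Qed.

Lemma loop_out_itv t : 0 <= loop_out t <= 1.
Proof. by apply: clamp_diff; lra. Qed.

Lemma loop_up_itv t : 0 <= loop_up t <= 1.
Proof. by apply: clamp_diff; lra. Qed.

Lemma loop_out_first t : t <= 4^-1 -> loop_out t = 0.
Proof. by move=> ?; rewrite /loop_out !clamp_le0 ?subrr//; lra. Qed.

Lemma loop_up_first t : t <= 4^-1 -> loop_up t = clamp (4 * t).
Proof. by move=> ?; rewrite /loop_up (@clamp_le0 _ (_ - 2)) ?subr0//; lra. Qed.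

Lemma loop_after t : 4^-1 <= t ->
  [\/ loop_up t = 1, loop_out t = 1 | loop_up t = 0].
Proof.
move=> t4; have [t2|t2] := lerP t 2^-1.
  constructor 1.
  by rewrite /loop_up (@clamp_le0 _ (_ - 2)) ?(@clamp_ge1 _ (4 * t)) ?subr0//; lra.
have [t3|t3] := lerP t (3 / 4).
  constructor 2.
  by rewrite /loop_out (@clamp_le0 _ (_ - 3)) ?(@clamp_ge1 _ (_ - 1)) ?subr0//; lra.
by constructor 3; rewrite /loop_up !clamp_ge1 ?subrr//; lra.
Qed.

Lemma loop_out1 : loop_out 1 = loop_out 0.
Proof. by rewrite [RHS]loop_out_first /loop_out ?clamp_ge1 ?subrr//; lra. Qed.

Lemma loop_up1 : loop_up 1 = loop_up 0.
Proof.
rewrite [RHS]loop_up_first ?mulr0 ?clamp0; last by lra.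
by rewrite /loop_up !clamp_ge1 ?subrr//; lra.
Qed.

Lemma meridian_boundary t :
  handlebody_boundary g (meridian_disc (loop_out t) (loop_up t)).
Proof.
apply: handlebody_boundaryP => //.
  by apply: meridian_disc_handlebody; [exact: loop_out_itv|exact: loop_up_itv].
rewrite /rad2 /meridian_disc /= expr0n /= addr0.
have [t4|t4] := lerP t 4^-1.
  by constructor 3; rewrite loop_out_first//; ring.
case: (loop_after (ltW t4)) => ->; first by constructor 2.
- by constructor 4; rewrite /L; ring.
- by constructor 1.
Qed.

Definition meridian t : S :=
  exist _ (meridian_disc (loop_out t) (loop_up t)) (mem_set (meridian_boundary t)).

Lemma set_val_meridian t :
  set_val (meridian t) = meridian_disc (loop_out t) (loop_up t).
Proof. by []. Qed.

Let continuous_clamp_affine (c d : R) : continuous (fun t => clamp (c * t - d)).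
Proof.
move=> t; apply: (@continuous_comp _ _ _ (fun t => c * t - d) (@clamp R));
  last exact: continuous_clamp.
apply: cvgB; last exact: cvg_cst.
by apply: cvgM; [exact: cvg_cst|exact: cvg_id].
Qed.

Let continuous_loop_out : continuous loop_out.
Proof. by move=> t; apply: cvgB; exact: continuous_clamp_affine. Qed.

Let continuous_loop_up : continuous loop_up.
Proof.
move=> t; apply: cvgB; last exact: continuous_clamp_affine.
by have := @continuous_clamp_affine 4 0 t; under eq_fun do rewrite subr0.
Qed.

Let continuous_disc (Z : topologicalType) (a b : Z -> R) z :
  {for z, continuous a} -> {for z, continuous b} ->
  {for z, continuous (fun z => meridian_disc (a z) (b z))}.
Proof.
move=> ca cb; apply: continuous_pair => //; apply: continuous_pair; last exact: cvg_cst.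
by apply: cvgB; [exact: cvg_cst|apply: cvgM => //; exact: cvg_cst].
Qed.

Lemma continuous_meridian : continuous meridian.
Proof.
move=> t; apply: continuous_into_set_type.
by apply: continuous_disc; [exact: continuous_loop_out|exact: continuous_loop_up].
Qed.

Lemma meridian1 : meridian 1 = meridian 0.
Proof. by apply: surface_eq; rewrite !set_val_meridian loop_out1 loop_up1. Qed.

(** The meridian contracts in the disc that it bounds, to the corner that is its
origin. *)
Lemma meridian_degree_extends (v : S -> R) :
  extends_to_circle v -> degree (v \o meridian) 0.
Proof.
move=> [_ [V cV Vv]].
have in_disc (y : R * R) : handlebody g
    (meridian_disc (clamp y.1 * loop_out y.2) (clamp y.1 * loop_up y.2)).
  have := clamp_itv y.1; have := loop_out_itv y.2; have := loop_up_itv y.2.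
  move: (clamp _) (loop_out _) (loop_up _) => c a b ? ? ?.
  by apply: meridian_disc_handlebody; apply/andP; split; nra.
pose D (y : R * R) : H := exist _ (meridian_disc (clamp y.1 * loop_out y.2)
  (clamp y.1 * loop_up y.2)) (mem_set (in_disc y)).
have cD : continuous D.
  move=> y; apply: continuous_into_set_type.
  have cc : {for y, continuous (fun y : R * R => clamp y.1)}.
    apply: (@continuous_comp _ _ _ fst (@clamp R)); first exact: cvg_fst.
    exact: continuous_clamp.
  apply: continuous_disc; apply: cvgM => //.
  - apply: (@continuous_comp _ _ _ snd loop_out); first exact: cvg_snd.
    exact: continuous_loop_out.
  - apply: (@continuous_comp _ _ _ snd loop_up); first exact: cvg_snd.
    exact: continuous_loop_up.
have set_val_D y : set_val (D y) =
  meridian_disc (clamp y.1 * loop_out y.2) (clamp y.1 * loop_up y.2) by [].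
have Deq y y' : set_val (D y) = set_val (D y') -> D y = D y' by exact: val_inj.
have : degree (fun t => V (D (1, t))) 0.
  apply: (@degree_homotopy R (V \o D)).
  - by move=> y; apply: circle_cvg_comp; [exact: cD|exact: cV].
  - move=> s; rewrite /= (Deq (s, 1) (s, 0)) ?subrr ?rpred0//.
    by rewrite !set_val_D /= loop_out1 loop_up1.
  - apply: degree_eq (degree_cst (V (D (0, 0)))) => t _ /=; congr V; apply: Deq.
    by rewrite !set_val_D /= clamp0 !mul0r.
apply: degree_eq => t _; apply: Vv.
by rewrite set_val_D set_val_meridian /= clamp1 !mul1r.
Qed.

(** The angle around the hole of index 0, whose centre is the origin. *)
Definition hole_angle (x : S) : R := angle (set_val x).1.

Let neq0_rad2 (p : Defs.space R) : 1 <= rad2 p -> p.1 != 0.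
Proof.
move=> p1; apply/eqP => p0; move: p1.
by rewrite /rad2 p0 /= expr0n /= addr0; lra.
Qed.

Lemma hole_angle_extends : extends_to_circle hole_angle.
Proof.
have cc (A : set (Defs.space R)) : (forall x : set_type A, 1 <= rad2 (set_val x)) ->
    circle_continuous (fun x : set_type A => angle (set_val x).1).
  move=> A1 x.
  apply: (@circle_cvg_comp R _ _ (@angle R) (fun x : set_type A => (set_val x).1)).
    apply: (@continuous_comp _ _ _ (set_val : set_type A -> Defs.space R) fst);
      last exact: cvg_fst.
    exact: continuous_set_val.
  exact/circle_cvg_angle/neq0_rad2/A1.
split; first by apply: cc => x; exact: (boundary_rad2_ge1 g_gt0 (surface_boundary x)).
exists (fun y : H => angle (set_val y).1).
  by apply: cc => y; apply: (handlebody_rad2_ge1 g_gt0); exact: set_valP.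
by move=> x y ->.
Qed.

Lemma hole_angle_twist (k : int) t : exists2 c : R,
  hole_angle (twist k (meridian t)) - 2^-1 - c \is a Num.int &
  c = if loop_out t == 0 then k%:~R * loop_up t else 0.
Proof.
have cos_half : cos (2 * pi * 2^-1 : R) = -1.
  by rewrite mulrAC divff// mul1r cospi.
have sin_half : sin (2 * pi * 2^-1 : R) = 0.
  by rewrite mulrAC divff// mul1r sinpi.
eexists; last by [].
have := loop_out_itv t.
rewrite /hole_angle /twist set_val_spin /spin /height set_val_meridian.
move: (loop_out t) (loop_up t) => a b a01.
have -> : (rad2 (meridian_disc a b) == 1) = (a == 0).
  rewrite /rad2 /= expr0n /= addr0; apply/eqP/eqP => [|->]; last by ring.
  move=> h; have := L4; have : (L - 1) * a * ((L - 1) * a + 2) = 0 by nra.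
  move=> /eqP; rewrite !mulf_eq0 => /orP[/orP[]|]/eqP => h1 h2; nra.
case: ifP => [/eqP ->|_].
- set c := k%:~R * b; rewrite -addrA -opprD.
  rewrite (_ : (rot _ _).1 =
    (1 * cos (2 * pi * (2^-1 + c)), 1 * sin (2 * pi * (2^-1 + c)))).
    exact: angle_polar.
  rewrite /rot /= (mulrDr (2 * pi) 2^-1 c) cosD sinD cos_half sin_half.
  by congr pair; ring.
- rewrite subr0.
  rewrite (_ : (meridian_disc _ _).1 =
    ((1 + (L - 1) * a) * cos (2 * pi * 2^-1),
     (1 + (L - 1) * a) * sin (2 * pi * 2^-1))).
    by apply: angle_polar; have := L4; nra.
  by rewrite cos_half sin_half; congr pair; ring.
Qed.

(** The angle is constant, equal to 1/2, on the meridian; the twist changes it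
only on the first quarter, where it adds [k] times the height. *)
Lemma meridian_degree_twist (k : int) :
  degree (fun t => hole_angle (twist k (meridian t))) k.
Proof.
exists (fun t => 2^-1 + k%:~R * clamp (4 * t)); split.
- move=> t; apply: cvgD; first exact: cvg_cst.
  apply: cvgM; first exact: cvg_cst.
  by have := @continuous_clamp_affine 4 0 t; under eq_fun do rewrite subr0.
- move=> t t01; have [c hc cE] := hole_angle_twist k t.
  rewrite (_ : _ - _ = (hole_angle (twist k (meridian t)) - 2^-1 - c) +
    (c - k%:~R * clamp (4 * t))); last by ring.
  rewrite rpredD// cE.
  have [t4|t4] := lerP t 4^-1.
    by rewrite loop_out_first// eqxx loop_up_first// subrr rpred0.
  rewrite (@clamp_ge1 _ (4 * t)) ?mulr1; last by lra.
  case: ifP => h; last by rewrite sub0r rpredN intr_int.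
  case: (loop_after (ltW t4)) => [->|h1|->].
  + by rewrite mulr1 subrr rpred0.
  + by move: h; rewrite h1 oner_eq0.
  + by rewrite mulr0 sub0r rpredN intr_int.
- by rewrite mulr0 mulr1 clamp0 clamp_ge1; [ring|lra].
Qed.

(** If the angle composed with the twist is homotopic to [v + d w], comparing
degrees on the meridian gives [k = 0 + d n], with [n] the degree of [w]. *)
Lemma trivial_mod_twist_dvd d k : trivial_mod d (twist k%:Z) -> (d %| k)%N.
Proof.
move=> /(_ _ hole_angle_extends)[v [w [ev cw [K [cK K0 K1]]]]].
have [n wn] : exists n, degree (w \o meridian) n.
  apply: degree_exists.
    by move=> t; apply: circle_cvg_comp; [exact: continuous_meridian|exact: cw].
  by rewrite /= meridian1 subrr rpred0.
have kn : degree (fun t => v (meridian t) + w (meridian t) *+ d) (0 + n *+ d).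
  exact: degreeD (meridian_degree_extends ev) (degreeMn d wn).
have : degree (fun t => K (1, meridian t)) k%:Z.
  apply: (@degree_homotopy R (fun y => K (y.1, meridian y.2))).
  - move=> y; apply: (@circle_cvg_comp R _ _ K (fun y => (y.1, meridian y.2))) => //.
    apply: continuous_pair; first exact: cvg_fst.
    by apply: (@continuous_comp _ _ _ snd meridian); [exact: cvg_snd|exact: continuous_meridian].
  - by move=> s; rewrite /= meridian1 subrr rpred0.
  - by apply: degree_eq (meridian_degree_twist k) => t _; rewrite K0.
move=> /(degree_eq (fun t _ => K1 (meridian t))) /degree_uniq/(_ kn).
rewrite add0r => kE; apply/dvdnP; exists `|n|%N.
have := congr1 absz kE; rewrite absz_nat => ->.
by rewrite -mulr_natr abszM natz.
Qed.

End Meridian.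

(** * Infinitely many independent quasi-invariants *)

Section IndependentFunctions.
Variables (R : realType) (X : Type) (nu : X -> nat).
Hypothesis nu_surj : forall k, exists x, nu x = k.

(** The supports of these functions, for distinct [j], are disjoint, and [nu] is
unbounded on each of them. *)
Definition dyadic_part (j : nat) (x : X) : R :=
  if logn 2 (nu x) == j then (nu x)%:R else 0.

Lemma logn_odd_multiple j m : logn 2 (2 ^ j * (2 * m).+1) = j.
Proof.
rewrite lognM ?expn_gt0// pfactorK// logn_coprime ?addn0//.
by rewrite coprime2n /= oddM.
Qed.

Lemma dyadic_part_inj : injective dyadic_part.
Proof.
move=> i j ij; have [x nx] := nu_surj (2 ^ i * (2 * 0).+1).
have := congr1 (fun f => f x) ij; rewrite /dyadic_part nx logn_odd_multiple eqxx.
case: eqP => // _ /eqP; rewrite pnatr_eq0 muln_eq0 expn_eq0//.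
Qed.

Lemma dyadic_part_independent n (f : 'I_n -> X -> R) :
  injective f -> (forall i, range dyadic_part (f i)) -> ~ linearly_dependent f.
Proof.
move=> finj fdp [a [M [/rV0Pn[i ai0] M0 bound]]].
have /choice[jj jjE] : forall i, exists j, dyadic_part j = f i.
  by move=> i'; have [j _ <-] := fdp i'; exists j.
(* At points of index [2 ^ j (2 m + 1)] only the [i]-th term is nonzero, and
   [m] is chosen to make it exceed the bound. *)
pose m := (Num.truncn (M / `|a 0 i|)).+1.
have [x nx] := nu_surj (2 ^ jj i * (2 * m).+1).
have := bound x; rewrite (bigD1 i)//= big1 => [|k ki]; last first.
  rewrite -jjE /dyadic_part nx logn_odd_multiple.
  case: eqP => [E|_]; last by rewrite mulr0.
  by move: ki; rewrite (_ : k = i) ?eqxx//; apply: finj; rewrite -!jjE E.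
rewrite addr0 -jjE /dyadic_part nx logn_odd_multiple eqxx normrM normr_nat.
apply/negP; rewrite -leNgt mulrC -ler_pdivrMr ?normr_gt0//.
have Mm : M / `|a 0 i| <= m%:R.
  by apply: ltW; rewrite /m; apply: truncnS_gt.
apply: le_trans Mm _; rewrite ler_nat.
have : (0 < 2 ^ jj i)%N by rewrite expn_gt0.
nia.
Qed.

End IndependentFunctions.

Section TwistClasses.
Variables (R : realType) (g : nat).
Hypothesis g_gt0 : (0 < g)%N.
Variable o : orientation R (boundary_surface R g).
Local Open Scope quotient_scope.

Definition twist_class (k : nat) : mcg o :=
  \pi_(mcg o) (twist_ohomeo g_gt0 o k%:Z).

Lemma twist_class_dvd k l :
  heegaard_equiv (twist_class k) (twist_class l) -> (l %| k)%N.
Proof.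
move=> kl; apply: (@trivial_mod_twist_dvd R g g_gt0).
apply/(mcg_trivial_modE l (twist_ohomeo g_gt0 o k%:Z)).
by apply: (heegaard_trivial_mod kl); apply/mcg_trivial_modE; exact: twist_trivial_mod.
Qed.

Lemma twist_class_inj k l :
  heegaard_equiv (twist_class k) (twist_class l) -> k = l.
Proof.
move=> kl; apply/eqP; rewrite eqn_dvd (twist_class_dvd kl) andbT.
by apply: twist_class_dvd; rewrite /heegaard_equiv kl.
Qed.

(** The default value 0 is given to the mapping classes that are not equivalent
to any power of the twist. *)
Definition twist_index (phi : mcg o) : nat :=
  xget 0%N [set k | heegaard_equiv phi (twist_class k)].

Lemma twist_index_class k : twist_index (twist_class k) = k.
Proof. by apply: xget_unique => // l /twist_class_inj. Qed.

Lemma twist_index_equiv phi psi :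
  heegaard_equiv phi psi -> twist_index phi = twist_index psi.
Proof. by move=> E; rewrite /twist_index /heegaard_equiv E. Qed.

End TwistClasses.

Theorem corollary1p10 (R : realType) (g : nat) (hg : (1 < g)%N)
    (o : orientation R (boundary_surface R g)) :
  exists A : set (mcg o -> R),
    [/\ infinite_set A,
        forall f, A f -> quasi_invariant (@heegaard_equiv R g o) f &
        forall (n : nat) (f : 'I_n -> (mcg o -> R)),
          injective f -> (forall i, A (f i)) -> ~ linearly_dependent f].
Proof.
have g_gt0 : (0 < g)%N := ltnW hg.
pose nu := @twist_index R g g_gt0 o.
have nu_surj k : exists x, nu x = k.
  by exists (twist_class g_gt0 o k); exact: twist_index_class.
exists (range (dyadic_part R nu)); split.
- move=> fin; apply: infinite_nat.
  have inj := @dyadic_part_inj R _ _ nu_surj.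
  have := finite_preimage (fun i j _ _ => inj i j) fin.
  by apply: sub_finite_set => j _; exists j.
- move=> _ [j _ <-]; exists 0 => // x y xy.
  by rewrite /dyadic_part /nu (twist_index_equiv g_gt0 xy) subrr normr0.
- by move=> n f; exact: dyadic_part_independent.
Qed.
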